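(* Let $k$ be an algebraically closed field and let $D=P_1+\cdots+P_m$ be a reduced effective divisor of degree $m\ge1$ on $\mathbb P^1=\mathbb P^1_k$. Let $\mathcal E_\cdot$ be a finite parabolic bundle on $(\mathbb P^1,D)$ whose weights have denominators prime to the characteristic of $k$, and suppose that the underlying sheaf decomposes as $$\mathcal E_0=\bigoplus_{j=1}^{\operatorname{rk}\mathcal E}\mathcal O(d_j).$$ Then for every $j$ one has $-m<d_j\le 0$.
   Context: Parabolic bundles: for an integer $r\ge1$, objects of $\operatorname{Par}_{\frac1r}(X,D)$ (here $X=\mathbb P^1$) are pairs $(\mathcal E_\cdot,j)$ where $\mathcal E_\cdot:(\frac1r\mathbb Z)^{op}\to\operatorname{Vect}(X)$ is a functor to locally free sheaves of finite rank, $j:\mathcal E_\cdot\otimes\mathcal O_X(-D)\simeq\mathcal E_{\cdot+1}$ is a natural isomorphism compatible with the natural maps of both sides to $\mathcal E_\cdot$, and for $i\le i'<i+1$ the cokernel of $\mathcal E_{i'}\to\mathcal E_i$ is locally free as an $\mathcal O_D$-module. Parabolic bundles on $(X,D)$ with rational weights are the objects of the filtered colimit $\operatorname{Par}(X,D)=\varinjlim_r\operatorname{Par}_{\frac1r}(X,D)$ (over $r$ ordered by divisibility, the transition functor for $r|r'$ extending $\mathcal E_\cdot$ to $\frac1{r'}\mathbb Z$ by $\mathcal E_{\alpha}:=\mathcal E_{\lceil r\alpha\rceil/r}$). The weights of $\mathcal E_\cdot$ have denominators prime to the characteristic of $k$ when $\mathcal E_\cdot$ comes from an object of $\operatorname{Par}_{\frac1r}(X,D)$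 for some $r\ge 1$ prime to the characteristic of $k$ (no condition in characteristic $0$). The underlying sheaf is $\mathcal E_0$. Tensor structure: in the category of functors $(\frac1r\mathbb Z)^{op}\to\operatorname{Qcoh}(X)$ equipped with such an isomorphism $j$, put $\underline{\operatorname{Hom}}(\mathcal E_\cdot,\mathcal E'_\cdot)_i=\underline{\operatorname{Hom}}(\mathcal E_\cdot,\mathcal E'_{\cdot+i})$ (sheaf of morphisms); the tensor product is characterized by $\underline{\operatorname{Hom}}(\mathcal E_\cdot\otimes\mathcal E'_\cdot,\mathcal E''_\cdot)_\cdot\simeq\underline{\operatorname{Hom}}(\mathcal E_\cdot,\underline{\operatorname{Hom}}(\mathcal E'_\cdot,\mathcal E''_\cdot)_\cdot)_\cdot$. It restricts to $\operatorname{Par}_{\frac1r}(X,D)$ and is compatible with the transition functors. Finite: for a polynomial $P=\sum a_iT^i$ with coefficients in $\mathbb N$, $P(\mathcal E_\cdot)=\bigoplus_i(\mathcal E_\cdot^{\otimes i})^{\oplus a_i}$. $\mathcal E_\cdot$ is finite if there are two distinct polynomials $P,Q\in\mathbb N[T]$ with $P(\mathcal E_\cdot)\simeq Q(\mathcal E_\cdot)$. *)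

(* Defs.v *)
From HB Require Import structures.
From mathcomp Require Import all_boot all_order all_algebra.
From mathcomp Require Import mathcomp_extra boolp classical_sets functions cardinality.

Set Implicit Arguments.
Unset Strict Implicit.
Unset Printing Implicit Defensive.

Import Order.TTheory GRing.Theory Num.Theory.

Local Open Scope classical_set_scope.
Local Open Scope ring_scope.

(* The projective line over [k] is represented by its closed points, [Some a]
   being the point of coordinate [a] and [None] the point at infinity, with the
   Zariski topology, whose nonempty open sets are the cofinite ones.  A scheme
   of finite type over [k] and its set of closed points have the same lattice
   of open sets, hence the same sheaves. *)
Local Notation "x %:F" := (FracField.tofrac x).

Section ProjectiveLine.
Variable k : closedFieldType.

Definition P1 : choiceType := option k.

Definition ratfun : fieldType := {fraction {poly k}}.

Definition regular_at (x : P1) (f : ratfun) : Prop :=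
  match x : option k with
  | Some a => exists p q : {poly k}, q.[a] != 0 /\ f = p%:F / q%:F
  | None => exists p q : {poly k},
      [/\ q != 0, (size p <= size q)%N & f = p%:F / q%:F]
  end.

Definition uniformizer (x : P1) : ratfun :=
  if (x : option k) is Some a then ('X - a%:P)%:F else ('X%:F)^-1.

(* [f] has order at least [n] at [x] (always true when [f = 0]). *)
Definition ord_ge (x : P1) (n : int) (f : ratfun) : Prop :=
  regular_at x (f / uniformizer x ^ n).

Lemma regular_at1 x : regular_at x 1.
Proof.
case: x => [a|] /=.
  by exists 1, 1; rewrite hornerC oner_neq0 tofrac1 divr1.
by exists 1, 1; rewrite oner_neq0 leqnn tofrac1 divr1.
Qed.

Lemma regular_atB x f g : regular_at x f -> regular_at x g -> regular_at x (f - g).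
Proof.
have E (p q p' q' : {poly k}) : q != 0 -> q' != 0 ->
    p%:F / q%:F - p'%:F / q'%:F = (p * q' - p' * q)%:F / (q * q')%:F.
  move=> q0 q'0; rewrite tofracB !tofracM -mulNr addf_div ?tofrac_eq0 //.
  by rewrite mulNr.
case: x => [a|] /=.
  move=> [p [q [qa ->]]] [p' [q' [q'a ->]]].
  have nz (r : {poly k}) : r.[a] != 0 -> r != 0.
    by apply: contraNneq => ->; rewrite horner0.
  exists (p * q' - p' * q), (q * q'); rewrite E ?nz //; split=> //.
  by rewrite hornerM mulf_neq0.
move=> [p [q [q0 pq ->]]] [p' [q' [q'0 p'q' ->]]].
exists (p * q' - p' * q), (q * q'); rewrite E ?mulf_neq0 //; split=> //.
rewrite size_mul //; apply: leq_trans (size_polyD _ _) _.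
rewrite size_polyN geq_max; apply/andP; split.
  by apply: leq_trans (size_polyMleq _ _) _; rewrite -!subn1 leq_sub2r // leq_add2r.
by apply: leq_trans (size_polyMleq _ _) _; rewrite addnC -!subn1 leq_sub2r // leq_add2l.
Qed.

Lemma regular_atM x f g : regular_at x f -> regular_at x g -> regular_at x (f * g).
Proof.
case: x => [a|] /=.
  move=> [p [q [qa ->]]] [p' [q' [q'a ->]]].
  by exists (p * p'), (q * q'); rewrite hornerM mulf_neq0 // !tofracM mulf_div.
move=> [p [q [q0 pq ->]]] [p' [q' [q'0 p'q' ->]]].
exists (p * p'), (q * q'); rewrite mulf_neq0 // !tofracM mulf_div; split=> //.
rewrite [leqRHS]size_mul //; apply: leq_trans (size_polyMleq _ _) _.
by rewrite -!subn1 leq_sub2r // leq_add.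
Qed.

Lemma regular_at_uniformizer x : regular_at x (uniformizer x).
Proof.
case: x => [a|] /=.
  by exists ('X - a%:P), 1; rewrite hornerC oner_neq0 tofrac1 divr1.
exists 1, 'X; rewrite polyX_eq0 size_polyX size_poly1 tofrac1 div1r.
by split.
Qed.

Lemma uniformizer_neq0 x : uniformizer x != 0.
Proof.
by case: x => [a|] /=; rewrite ?invr_eq0 tofrac_eq0 ?polyXsubC_eq0 ?polyX_eq0.
Qed.

Lemma ord_geB x n f g : ord_ge x n f -> ord_ge x n g -> ord_ge x n (f - g).
Proof. by move=> Hf Hg; rewrite /ord_ge mulrBl; exact: regular_atB. Qed.

Lemma ord_ge0 x n : ord_ge x n 0.
Proof. by rewrite /ord_ge mul0r -(subrr 1); apply: regular_atB; exact: regular_at1. Qed.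

Lemma ord_geM x m n f g : ord_ge x m f -> ord_ge x n g -> ord_ge x (m + n) (f * g).
Proof.
rewrite /ord_ge expfzDr ?uniformizer_neq0 // => Hf Hg.
by rewrite invfM mulrACA; exact: regular_atM.
Qed.

Lemma regularE x f : ord_ge x 0 f = regular_at x f.
Proof. by rewrite /ord_ge expr0z divr1. Qed.

Lemma ord_ge_le x m n f : m <= n -> ord_ge x n f -> ord_ge x m f.
Proof.
have p0 := uniformizer_neq0 x => mn Hf; rewrite /ord_ge.
have -> : f / uniformizer x ^ m = f / uniformizer x ^ n * uniformizer x ^ (n - m).
  by rewrite expfzDr // mulrA divfK ?expfz_neq0 // invr_expz.
apply: regular_atM => //.
have -> : n - m = `|n - m|%N :> int by rewrite gez0_abs // subr_ge0.
elim: `|_|%N => [|d IH]; first exact: regular_at1.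
by rewrite exprSz; apply: regular_atM => //; exact: regular_at_uniformizer.
Qed.

Record zopen := ZOpen {
  zset :> set P1;
  zset_cofinite : finite_set (~` zset) }.

Definition zfull : zopen.
Proof. by exists setT; rewrite setCT. Defined.

Definition zcap (U V : zopen) : zopen.
Proof.
exists (zset U `&` zset V); rewrite setCI finite_setU.
by split; exact: zset_cofinite.
Defined.

Lemma zopen_nonempty (U : zopen) : zset U !=set0.
Proof.
have /finite_seqP[s sE] := zset_cofinite U.
pose p := \prod_(a <- pmap id s) ('X - a%:P) : {poly k}.
have p0 : p != 0 by apply/monic_neq0/monic_prod_XsubC.
have [a pa] := closed_nonrootP p p0.
exists (Some a); apply: contrapT => /= aU.
have : (~` zset U) (Some a) by [].
rewrite sE /= => as_; move/negP: pa; apply.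
by rewrite root_prod_XsubC mem_pmap; apply/mapP; exists (Some a).
Qed.

Definition regular (U : set P1) : {pred ratfun} :=
  fun f => `[< forall x, U x -> regular_at x f >].

Lemma regular_subring_closed U : subring_closed (regular U).
Proof.
split; first by apply/asboolP => x _; exact: regular_at1.
- move=> f g /asboolP Hf /asboolP Hg; apply/asboolP => x Ux.
  by apply: regular_atB; [exact: Hf | exact: Hg].
- move=> f g /asboolP Hf /asboolP Hg; apply/asboolP => x Ux.
  by apply: regular_atM; [exact: Hf | exact: Hg].
Qed.

HB.instance Definition _ U :=
  GRing.isSubringClosed.Build ratfun (regular U) (regular_subring_closed U).

(* O(U), for U nonempty. *)
Record regfun (U : set P1) := RegFun {
  regval :> ratfun;
  regvalP : regval \in regular U }.

HB.instance Definition _ U := [isSub for @regval U].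
HB.instance Definition _ U := [Choice of regfun U by <:].
HB.instance Definition _ U := [SubChoice_isSubComNzRing of regfun U by <:].

Lemma regular_sub (U V : set P1) (h : V `<=` U) (f : regfun U) :
  regval f \in regular V.
Proof. by apply/asboolP => x /h Ux; have /asboolP := regvalP f; exact. Qed.

Definition rres (U V : set P1) (h : V `<=` U) (f : regfun U) : regfun V :=
  RegFun (regular_sub h f).

(* Sheaves of O-modules on the projective line.  The value at the empty open
   set, which is zero, is left out. *)
Record sheaf := Sheaf {
  sect :> forall U : zopen, lmodType (regfun U);
  res : forall U V : zopen, V `<=` U -> sect U -> sect V;
  res_lin : forall (U V : zopen) (h : V `<=` U) (a : regfun U) (s t : sect U),
    res h (a *: s + t) = rres h a *: res h s + res h t;
  res_id : forall (U : zopen) (h : U `<=` U) (s : sect U), res h s = s;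
  res_comp : forall (U V W : zopen) (h : V `<=` U) (h' : W `<=` V)
    (h'' : W `<=` U) (s : sect U), res h' (res h s) = res h'' s;
  sheaf_sep : forall (U : zopen) (C : set zopen),
    (forall V : zopen, C V -> V `<=` U) ->
    (forall x, zset U x -> exists2 V, C V & zset V x) ->
    forall s t : sect U,
    (forall (V : zopen) (h : V `<=` U), C V -> res h s = res h t) -> s = t;
  sheaf_glue : forall (U : zopen) (C : set zopen),
    (forall V : zopen, C V -> V `<=` U) ->
    (forall x, zset U x -> exists2 V, C V & zset V x) ->
    forall t : (forall V : zopen, sect V),
    (forall V W : zopen, C V -> C W ->
       forall (h : zcap V W `<=` V) (h' : zcap V W `<=` W),
       res h (t V) = res h' (t W)) ->
    exists s : sect U, forall (V : zopen) (h : V `<=` U), C V -> res h s = t V }.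

(* Morphisms of O-modules, and O-bilinear maps F x G -> H; the latter are the
   same thing as morphisms from the tensor product of F and G to H. *)
Record smor (F G : sheaf) := SMor {
  smap :> forall U : zopen, F U -> G U;
  smap_lin : forall U, linear (@smap U);
  smap_res : forall (U V : zopen) (h : V `<=` U) (s : F U),
    smap (res h s) = res h (smap s) }.

Record bimor (F G H : sheaf) := BiMor {
  bimap :> forall U : zopen, F U -> G U -> H U;
  bimap_linl : forall U (t : G U), linear (fun s : F U => bimap s t);
  bimap_linr : forall U (s : F U), linear (bimap s);
  bimap_res : forall (U V : zopen) (h : V `<=` U) (s : F U) (t : G U),
    bimap (res h s) (res h t) = res h (bimap s t) }.

Definition siso (F G : sheaf) : Prop :=
  exists (f : smor F G) (g : smor G F),
    forall U, cancel (f U) (g U) /\ cancel (g U) (f U).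

Definition locally_free (F : sheaf) : Prop :=
  forall x : P1, exists2 U : zopen, zset U x &
    exists (n : nat) (e : 'I_n -> F U),
    forall (V : zopen) (h : V `<=` U) (s : F V),
    exists! c : {ffun 'I_n -> regfun V}, s = \sum_i c i *: res h (e i).

(* F(D(f)) is the localization of F(U) at f, for every f in O(U).  An open set
   other than the whole line is affine; on the whole line [f] is constant and
   the condition holds for any sheaf. *)
Definition quasi_coherent (F : sheaf) : Prop :=
  forall (U V : zopen) (h : V `<=` U) (f : regfun U),
  zset V = [set x | [/\ zset U x, regval f != 0 & regular_at x (regval f)^-1]] ->
  (forall s : F U, res h s = 0 -> exists n : nat, f ^+ n *: s = 0) /\
  (forall t : F V, exists (n : nat) (s : F U), res h s = rres h f ^+ n *: t).

(* Sections over [U] of the invertible sheaf O(delta) of a divisor [delta]. *)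
Definition osec_pred (delta : P1 -> int) (U : set P1) : {pred ratfun} :=
  fun f => `[< forall x, U x -> ord_ge x (- delta x) f >].

Lemma osec_zmod_closed delta U : zmod_closed (osec_pred delta U).
Proof.
split; first by apply/asboolP => x _; exact: ord_ge0.
move=> f g /asboolP Hf /asboolP Hg; apply/asboolP => x Ux.
by apply: ord_geB; [exact: Hf | exact: Hg].
Qed.

HB.instance Definition _ delta U :=
  GRing.isZmodClosed.Build ratfun (osec_pred delta U) (osec_zmod_closed delta U).

Record osec (delta : P1 -> int) (U : set P1) := OSec {
  osecval :> ratfun;
  osecvalP : osecval \in osec_pred delta U }.

HB.instance Definition _ delta U := [isSub for @osecval delta U].
HB.instance Definition _ delta U := [Choice of osec delta U by <:].
HB.instance Definition _ delta U := [SubChoice_isSubZmodule of osec delta U by <:].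

Section OSec.
Variables (delta : P1 -> int) (U : set P1).

Lemma osec_scale_subproof (a : regfun U) (f : osec delta U) :
  regval a * osecval f \in osec_pred delta U.
Proof.
apply/asboolP => x Ux; rewrite -[- _]add0r; apply: ord_geM.
  by rewrite regularE; have /asboolP := regvalP a; exact.
by have /asboolP := osecvalP f; exact.
Qed.

Definition osec_scale (a : regfun U) (f : osec delta U) : osec delta U :=
  OSec (osec_scale_subproof a f).

Lemma osec_scaleA a b f : osec_scale a (osec_scale b f) = osec_scale (a * b) f.
Proof. by apply/val_inj; rewrite /= mulrA. Qed.
Lemma osec_scale1 : left_id 1 osec_scale.
Proof. by move=> f; apply/val_inj; rewrite /= mul1r. Qed.
Lemma osec_scaleDr : right_distributive osec_scale +%R.
Proof. by move=> a f g; apply/val_inj; rewrite /= mulrDr. Qed.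
Lemma osec_scaleDl f : {morph osec_scale^~ f : a b / a + b}.
Proof. by move=> a b; apply/val_inj; rewrite /= mulrDl. Qed.

HB.instance Definition _ := GRing.Zmodule_isLmodule.Build (regfun U)
  (osec delta U) osec_scaleA osec_scale1 osec_scaleDr osec_scaleDl.

End OSec.

Lemma osec_sub delta (U V : set P1) (h : V `<=` U) (f : osec delta U) :
  osecval f \in osec_pred delta V.
Proof. by apply/asboolP => x /h Ux; have /asboolP := osecvalP f; exact. Qed.

Definition osec_res delta (U V : set P1) (h : V `<=` U) (f : osec delta U) :
  osec delta V := OSec (osec_sub h f).

Definition OX (delta : P1 -> int) : sheaf.
Proof.
apply: (@Sheaf (fun U => osec delta U) (fun U V => @osec_res delta U V)).
- by move=> U V h a s t; apply/val_inj.
- by move=> U h s; apply/val_inj.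
- by move=> U V W h h' h'' s; apply/val_inj.
- move=> U C CU HC s t Hst; have [x Ux] := zopen_nonempty U.
  have [V CV Vx] := HC x Ux.
  by apply/val_inj; have /(congr1 val) := Hst V (CU V CV) CV.
- move=> U C CU HC t Ht; have [x Ux] := zopen_nonempty U.
  have [V CV Vx] := HC x Ux.
  have tE W : C W -> osecval (t W) = osecval (t V).
    move=> CW; have /(congr1 val) := Ht W V CW CV (@subIsetl _ _ _) (@subIsetr _ _ _).
    exact.
  have tP : osecval (t V) \in osec_pred delta U.
    apply/asboolP => y /HC[W CW Wy]; rewrite -(tE W CW).
    by have /asboolP := osecvalP (t W); exact.
  by exists (OSec tP) => W h CW; apply/val_inj; rewrite /= tE.
Defined.


Definition szero : sheaf.
Proof.
apply: (@Sheaf (fun U => 'rV[regfun U]_0) (fun _ _ _ _ => 0)).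
- by move=> U V h a s t; rewrite scaler0 addr0.
- by move=> U h s; rewrite [s]thinmx0.
- by [].
- by move=> U C _ _ s t _; rewrite [s]thinmx0 [t]thinmx0.
- by move=> U C _ _ t _; exists 0 => V h _; rewrite [t V]thinmx0.
Defined.

Section SPlus.
Variables F G : sheaf.

Definition splus_res (U V : zopen) (h : V `<=` U) (s : (F U * G U)%type) :
  (F V * G V)%type := (res h s.1, res h s.2).

Definition splus : sheaf.
Proof.
apply: (@Sheaf (fun U => (F U * G U)%type) splus_res).
- by move=> U V h a s t; congr pair; exact: res_lin.
- by move=> U h [s s']; congr pair; exact: res_id.
- by move=> U V W h h' h'' s; congr pair; exact: res_comp.
- move=> U C CU HC [s s'] [t t'] Hst; congr pair; apply: (sheaf_sep CU HC);
    by move=> V h /(Hst V h) [].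
- move=> U C CU HC t Ht.
  have [s Hs] := sheaf_glue CU HC (t := fun V => (t V).1)
    (fun V W CV CW h h' => congr1 fst (Ht V W CV CW h h')).
  have [s' Hs'] := sheaf_glue CU HC (t := fun V => (t V).2)
    (fun V W CV CW h h' => congr1 snd (Ht V W CV CW h h')).
  exists (s, s') => V h CV; rewrite /splus_res /= (Hs V h CV) (Hs' V h CV).
  by case: (t V).
Defined.

End SPlus.

(* An effective divisor is given as the sequence of its points, repeated
   according to multiplicity; it is reduced when the sequence is [uniq]. *)
Definition divisor (D : seq P1) (x : P1) : int := (count_mem x D)%:Z.

Definition Oideal (D : seq P1) : sheaf := OX (fun x => - divisor D x).

Lemma ideal_val_subproof D (U : zopen) (f : Oideal D U) :
  osecval f \in regular U.
Proof.
apply/asboolP => x Ux; rewrite -regularE.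
have /asboolP/(_ x Ux) := osecvalP f.
by rewrite opprK; exact: ord_ge_le.
Qed.

Definition ideal_val D (U : zopen) (f : Oideal D U) : regfun U :=
  RegFun (ideal_val_subproof f).

Definition ideal_generator D (U : zopen) (f : Oideal D U) : Prop :=
  forall (V : zopen) (h : V `<=` U) (g : Oideal D V),
  exists a : regfun V, g = a *: res h f.

(* The cokernel of [f : F -> G] is locally free as a module over
   O_D = O/O(-D): near every point there are sections [e] of G that induce an
   isomorphism from O_D^n onto the cokernel, i.e. generate it and satisfy
   exactly the relations with coefficients in O(-D). *)
Definition locally_in_image (F G : sheaf) (f : smor F G) (U : zopen) (t : G U) :
    Prop :=
  forall x, zset U x -> exists (V : zopen) (h : V `<=` U) (s : F V),
    zset V x /\ f V s = res h t.

Definition coker_locally_free (D : seq P1) (F G : sheaf) (f : smor F G) : Prop :=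
  forall x : P1, exists2 U : zopen, zset U x &
    exists (n : nat) (e : 'I_n -> G U),
    (forall (V : zopen) (h : V `<=` U) (t : G V) y, zset V y ->
       exists (W : zopen) (h' : W `<=` V) (c : 'I_n -> regfun W),
       zset W y /\ locally_in_image f
         (res h' t - \sum_i c i *: res (subset_trans h' h) (e i))) /\
    (forall (V : zopen) (h : V `<=` U) (c : 'I_n -> regfun V),
       locally_in_image f (\sum_i c i *: res h (e i)) <->
       forall i, exists g : Oideal D V, c i = ideal_val g).

(* Functors from the opposite of the ordered set (1/r)Z to O-modules, with
   j : E(-D) ~ E_{.+1}.  The term of index [i] is E_{i/r}, so that E_{.+1} is
   the shift of indices by [r]; [trans] is defined for every inequality and
   [jmap] for every equality [i' = i + r], which avoids casts.  The map [jmap]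
   is given as a bilinear map on E_i x O(-D); the morphism it induces on
   E_i(-D) is an isomorphism when multiplication by a generator of O(-D) is
   bijective wherever there is one. *)
Record psheaf (D : seq P1) (r : nat) := PSheaf {
  pterm :> int -> sheaf;
  trans : forall i i' : int, i <= i' -> smor (pterm i') (pterm i);
  trans_id : forall (i : int) (le : i <= i) (U : zopen) (s : pterm i U),
    trans le U s = s;
  trans_comp : forall (i i' i'' : int) (le : i <= i') (le' : i' <= i'')
    (le'' : i <= i'') (U : zopen) (s : pterm i'' U),
    trans le U (trans le' U s) = trans le'' U s;
  jmap : forall i i' : int, i' = i + r%:Z ->
    bimor (pterm i) (Oideal D) (pterm i');
  jmap_iso : forall (i i' : int) (e : i' = i + r%:Z) (U : zopen)
    (f : Oideal D U),
    ideal_generator f -> bijective (fun s : pterm i U => jmap e U s f);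
  jmap_natural : forall (i1 i2 i1' i2' : int) (e1 : i1' = i1 + r%:Z)
    (e2 : i2' = i2 + r%:Z) (le : i1 <= i2) (le' : i1' <= i2') (U : zopen)
    (s : pterm i2 U) (f : Oideal D U),
    trans le' U (jmap e2 U s f) = jmap e1 U (trans le U s) f;
  jmap_trans : forall (i i' : int) (e : i' = i + r%:Z) (le : i <= i')
    (U : zopen) (s : pterm i U) (f : Oideal D U),
    trans le U (jmap e U s f) = ideal_val f *: s }.

(* The objects of Par_{1/r}(P^1, D). *)
Definition parabolic (D : seq P1) (r : nat) (E : psheaf D r) : Prop :=
  (forall i, locally_free (E i)) /\
  (forall (i i' : int) (le : i <= i'),
     i' < i + r%:Z -> coker_locally_free D (trans E le)).

Record pmor (D : seq P1) (r : nat) (E E' : psheaf D r) := PMor {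
  pmor_map :> forall i : int, smor (E i) (E' i);
  pmap_trans : forall (i i' : int) (le : i <= i') (U : zopen) (s : E i' U),
    pmor_map i U (trans E le U s) = trans E' le U (pmor_map i' U s);
  pmap_jmap : forall (i i' : int) (e : i' = i + r%:Z) (U : zopen) (s : E i U)
    (f : Oideal D U),
    pmor_map i' U (jmap E e U s f) = jmap E' e U (pmor_map i U s) f }.

Definition piso (D : seq P1) (r : nat) (E E' : psheaf D r) : Prop :=
  exists (f : pmor E E') (g : pmor E' E), forall i U,
    cancel (f i U) (g i U) /\ cancel (g i U) (f i U).

(* A morphism from E to the internal Hom(E', E''), uncurried: the component of
   degree a of such a morphism sends a section of E_a to a morphism
   E' -> E''_{.+a}, that is, to a family of maps E'_b -> E''_{a+b}. *)
Record pairing (D : seq P1) (r : nat) (E E' E'' : psheaf D r) := Pairing {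
  pair_map :> forall a b : int, bimor (E a) (E' b) (E'' (a + b));
  pair_transl : forall (a a' b : int) (le : a <= a') (le' : a + b <= a' + b)
    (U : zopen) (s : E a' U) (t : E' b U),
    pair_map a b U (trans E le U s) t = trans E'' le' U (pair_map a' b U s t);
  pair_transr : forall (a b b' : int) (le : b <= b') (le' : a + b <= a + b')
    (U : zopen) (s : E a U) (t : E' b' U),
    pair_map a b U s (trans E' le U t) = trans E'' le' U (pair_map a b' U s t);
  pair_jmapl : forall (a a' b : int) (e : a' = a + r%:Z)
    (e' : a' + b = a + b + r%:Z) (U : zopen) (s : E a U) (t : E' b U)
    (f : Oideal D U),
    pair_map a' b U (jmap E e U s f) t = jmap E'' e' U (pair_map a b U s t) f;
  pair_jmapr : forall (a b b' : int) (e : b' = b + r%:Z)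
    (e' : a + b' = a + b + r%:Z) (U : zopen) (s : E a U) (t : E' b U)
    (f : Oideal D U),
    pair_map a b' U s (jmap E' e U t f) = jmap E'' e' U (pair_map a b U s t) f }.

(* [T] is the tensor product of [E] and [E'], i.e. it represents the functor
   E'' |-> Hom(E, Hom(E', E'')) on quasi-coherent [E'']. *)
Definition is_tensor (D : seq P1) (r : nat) (E E' T : psheaf D r) : Prop :=
  exists p : pairing E E' T,
  forall E'' : psheaf D r, (forall i, quasi_coherent (E'' i)) ->
  forall q : pairing E E' E'',
  (exists f : pmor T E'', forall a b U (s : E a U) (t : E' b U),
     f (a + b) U (p a b U s t) = q a b U s t) /\
  (forall f f' : pmor T E'',
     (forall a b U (s : E a U) (t : E' b U),
        f (a + b) U (p a b U s t) = f' (a + b) U (p a b U s t)) ->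
     forall i U (s : T i U), f i U s = f' i U s).

(* ceil (i / r') for the index i/r' and a structure of level r: the smallest
   integer c with c/r >= i/r'. *)
Definition ceil_index (r r' : nat) (i : int) : int :=
  - ((- (i * r%:Z)) %/ r'%:Z)%Z.

Lemma ceil_index_le r r' i i' : i <= i' -> ceil_index r r' i <= ceil_index r r' i'.
Proof.
by move=> le; rewrite lerN2 lez_pdiv2r // lerN2 ler_wpM2r.
Qed.

Lemma ceil_index_shift r r' i i' : (0 < r')%N -> i' = i + r'%:Z ->
  ceil_index r r' i' = ceil_index r r' i + r%:Z.
Proof.
move=> r'0 ->; rewrite /ceil_index.
have -> : - ((i + r'%:Z) * r%:Z) = - r%:Z * r'%:Z + - (i * r%:Z).
  by rewrite mulrDl opprD addrC [r'%:Z * _]mulrC mulNr.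
by rewrite divzMDl ?eqz_nat -?lt0n // opprD opprK addrC.
Qed.

(* The extension E_alpha := E_{ceil(r alpha)/r} of [E] to (1/r')Z. *)
Definition extend (D : seq P1) (r r' : nat) (r'_gt0 : (0 < r')%N)
  (E : psheaf D r) : psheaf D r'.
Proof.
refine (@PSheaf D r' (fun i => E (ceil_index r r' i))
  (fun i i' le => trans E (ceil_index_le r r' le)) _ _
  (fun i i' e => jmap E (ceil_index_shift r r'_gt0 e)) _ _ _).
- by move=> i le U s; exact: trans_id.
- by move=> i i' i'' le le' le'' U s; exact: trans_comp.
- by move=> i i' e U f; exact: jmap_iso.
- by move=> i1 i2 i1' i2' e1 e2 le le' U s f; exact: jmap_natural.
- by move=> i i' e le U s f; exact: jmap_trans.
Defined.

Definition szero_mor : smor szero szero.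
Proof.
exists (fun U s => s) => //.
Defined.

Definition szero_bimor (G : sheaf) : bimor szero G szero.
Proof.
exists (fun U s t => 0).
- by move=> U t a s s'; rewrite scaler0 addr0.
- by move=> U s a t t'; rewrite scaler0 addr0.
- by [].
Defined.

Definition pzero (D : seq P1) (r : nat) : psheaf D r.
Proof.
refine (@PSheaf D r (fun _ => szero) (fun _ _ _ => szero_mor) _ _
  (fun _ _ _ => szero_bimor _) _ _ _).
- by [].
- by [].
- by move=> i i' e U f _; exists id => s; apply/esym/thinmx0.
- by [].
- by move=> i i' e le U s f; rewrite [_ *: _]thinmx0.
Defined.

Definition splus_mor (F F' G G' : sheaf) (f : smor F G) (f' : smor F' G') :
  smor (splus F F') (splus G G').
Proof.
exists (fun U (s : splus F F' U) => (f U s.1, f' U s.2) : splus G G' U).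
- by move=> U a s t; congr pair; exact: smap_lin.
- by move=> U V h s; congr pair; exact: smap_res.
Defined.

Definition splus_bimor (F F' G H H' : sheaf) (f : bimor F G H) (f' : bimor F' G H') :
  bimor (splus F F') G (splus H H').
Proof.
exists (fun U (s : splus F F' U) t => (f U s.1 t, f' U s.2 t) : splus H H' U).
- by move=> U t a s s'; congr pair; exact: bimap_linl.
- by move=> U s a t t'; congr pair; exact: bimap_linr.
- by move=> U V h s t; congr pair; exact: bimap_res.
Defined.

Definition pplus (D : seq P1) (r : nat) (E E' : psheaf D r) : psheaf D r.
Proof.
refine (@PSheaf D r (fun i => splus (E i) (E' i))
  (fun i i' le => splus_mor (trans E le) (trans E' le)) _ _
  (fun i i' e => splus_bimor (jmap E e) (jmap E' e)) _ _ _).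
- by move=> i le U [s s']; congr pair; exact: trans_id.
- by move=> i i' i'' le le' le'' U s; congr pair; exact: trans_comp.
- move=> i i' e U f gf.
  have [g gK Kg] := @jmap_iso D r E i i' e U f gf.
  have [g' gK' Kg'] := @jmap_iso D r E' i i' e U f gf.
  exists (fun s : splus (E i') (E' i') U => (g s.1, g' s.2)).
    by move=> [s s'] /=; rewrite gK gK'.
  by move=> [s s'] /=; rewrite Kg Kg'.
- by move=> i1 i2 i1' i2' e1 e2 le le' U s f; congr pair; exact: jmap_natural.
- by move=> i i' e le U s f; congr pair; exact: jmap_trans.
Defined.

Lemma OX_incl_subproof (delta delta' : P1 -> int) (U : zopen) (f : OX delta U) :
  (forall x, delta x <= delta' x) -> osecval f \in osec_pred delta' U.
Proof.
move=> le; apply/asboolP => x Ux; have /asboolP/(_ x Ux) := osecvalP f.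
by apply: ord_ge_le; rewrite lerN2.
Qed.

Definition OX_incl (delta delta' : P1 -> int) (le : forall x, delta x <= delta' x) :
  smor (OX delta) (OX delta').
Proof.
exists (fun U f => OSec (OX_incl_subproof f le) : OX delta' U).
- by move=> U a s t; apply/val_inj.
- by move=> U V h s; apply/val_inj.
Defined.

Lemma OX_mul_subproof (delta delta' delta'' : P1 -> int) (U : zopen)
    (f : OX delta U) (g : OX delta' U) :
  (forall x, delta'' x = delta x + delta' x) ->
  osecval f * osecval g \in osec_pred delta'' U.
Proof.
move=> e; apply/asboolP => x Ux; rewrite e opprD; apply: ord_geM.
  by have /asboolP := osecvalP f; exact.
by have /asboolP := osecvalP g; exact.
Qed.

Definition OX_mul (delta delta' delta'' : P1 -> int)
  (e : forall x, delta'' x = delta x + delta' x) :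
  bimor (OX delta) (OX delta') (OX delta'').
Proof.
exists (fun U f g => OSec (OX_mul_subproof f g e) : OX delta'' U).
- by move=> U t a s s'; apply/val_inj; rewrite /= mulrDl mulrA.
- by move=> U s a t t'; apply/val_inj; rewrite /= mulrDr mulrCA.
- by move=> U V h s t; apply/val_inj.
Defined.

(* A generator of O(-D) has order exactly D(x) at every point x. *)
Lemma ideal_generatorP D (U : zopen) (f : Oideal D U) : ideal_generator f ->
  osecval f != 0 /\
  forall x, zset U x -> ord_ge x (- divisor D x) (osecval f)^-1.
Proof.
move=> gf.
suff H x : zset U x ->
    osecval f != 0 /\ ord_ge x (- divisor D x) (osecval f)^-1.
  have [x Ux] := zopen_nonempty U; split; first by have [] := H x Ux.
  by move=> y Uy; have [] := H y Uy.
move=> Ux; pose bad : seq P1 := None :: Some 0 :: D.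
have Wfin : finite_set (~` [set y : P1 | y = x \/ y \notin bad]).
  apply: (@sub_finite_set _ _ [set` bad]); last exact: finite_seq.
  by move=> y /= /not_orP[_ /negP]; rewrite negbK.
pose V := zcap U (ZOpen Wfin); pose h : V `<=` U := @subIsetl _ _ _.
pose p := uniformizer x ^ divisor D x.
have p0 : p != 0 by rewrite expfz_neq0 // uniformizer_neq0.
have reg0 y g : ord_ge y 0 g -> ord_ge y 0 (g ^ divisor D x).
  rewrite !regularE /divisor => Hg; elim: (count_mem _ _) => [|n IH].
    exact: regular_at1.
  by rewrite exprSz; exact: regular_atM.
have pP : p \in osec_pred (fun y => - divisor D y) V.
  apply/asboolP => y [_ /= Wy]; rewrite opprK.
  have [->|/eqP yx] := pselect (y = x).
    by rewrite /ord_ge divff //; exact: regular_at1.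
  case: Wy => [yE|]; first by rewrite yE eqxx in yx.
  rewrite !inE !negb_or => /and3P[yN y0 yD].
  have -> : divisor D y = 0.
    by rewrite /divisor (count_memPn yD).
  apply: reg0; rewrite regularE.
  case: x yx {Ux bad Wfin V h p p0 yD} => [a|] yx; case: y yN y0 yx => [c|] //= _ c0 _.
    by exists ('X - a%:P), 1; rewrite hornerC oner_neq0 tofrac1 divr1.
  by exists 1, 'X; rewrite hornerX tofrac1 div1r.
have [a /(congr1 val) /= aE] := gf V h (OSec pP).
have f0 : osecval f != 0.
  by apply: contraNneq p0; rewrite aE => ->; rewrite mulr0.
split=> //; rewrite /ord_ge -invr_expz -/p invrK.
have -> : (osecval f)^-1 * p = regval a.
  by rewrite aE mulrCA mulVf // mulr1.
have /asboolP := regvalP a; apply; split=> //=; by left.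
Qed.

Lemma unit1_le D (i i' : int) (le : i <= i') x :
  - (i' * divisor D x) <= - (i * divisor D x).
Proof. by rewrite lerN2 /divisor ler_wpM2r. Qed.

Lemma unit1_shift D (i i' : int) (e : i' = i + 1%N%:Z) x :
  - (i' * divisor D x) = - (i * divisor D x) + - divisor D x.
Proof. by rewrite e mulrDl opprD mul1r. Qed.

Definition unit1 (D : seq P1) : psheaf D 1.
Proof.
refine (@PSheaf D 1 (fun i => OX (fun x => - (i * divisor D x)))
  (fun i i' le => OX_incl (unit1_le D le)) _ _
  (fun i i' e => OX_mul (unit1_shift D e)) _ _ _).
- by move=> i le U s; apply/val_inj.
- by move=> i i' i'' le le' le'' U s; apply/val_inj.
- move=> i i' e U f /ideal_generatorP[f0 fV].
  have P (s : OX (fun x => - (i' * divisor D x)) U) :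
      osecval s / osecval f \in osec_pred (fun x => - (i * divisor D x)) U.
    apply/asboolP => x Ux.
    have -> : - - (i * divisor D x) = - - (i' * divisor D x) + - divisor D x.
      by rewrite !opprK e mulrDl mul1r addrK.
    by apply: ord_geM; [have /asboolP := osecvalP s; exact | exact: fV].
  exists (fun s => OSec (P s)) => s; apply/val_inj => /=.
    by rewrite mulfK.
  by rewrite divfK.
- by move=> i1 i2 i1' i2' e1 e2 le le' U s f; apply/val_inj.
- by move=> i i' e le U s f; apply/val_inj; rewrite /= mulrC.
Defined.

(* The unit of the tensor product, alpha |-> O(- ceil(alpha) D). *)
Definition punit (D : seq P1) (r : nat) (r_gt0 : (0 < r)%N) : psheaf D r :=
  extend r_gt0 (unit1 D).

Definition is_tensor_powers (D : seq P1) (r : nat) (r_gt0 : (0 < r)%N)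
    (E : psheaf D r) (T : nat -> psheaf D r) : Prop :=
  [/\ T 0 = punit D r_gt0,
      forall n, parabolic (T n) &
      forall n, is_tensor E (T n) (T n.+1)].

(* P(E), where [T i] is the i-th tensor power of E. *)
Definition peval (D : seq P1) (r : nat) (T : nat -> psheaf D r) (P : {poly nat}) :
    psheaf D r :=
  \big[@pplus D r/pzero D r]_(i < size P) iter (P`_i)%R (pplus (T i)) (pzero D r).

Definition finite_at (D : seq P1) (r : nat) (r_gt0 : (0 < r)%N) (E : psheaf D r) :
    Prop :=
  exists (T : nat -> psheaf D r) (P Q : {poly nat}),
    [/\ is_tensor_powers r_gt0 E T, P != Q & piso (peval T P) (peval T Q)].

(* Finiteness and the condition on weights in the colimit Par(P^1, D): two
   objects become isomorphic there if and only if they have isomorphic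
   extensions to a common level. *)
Definition finite_parabolic (D : seq P1) (r : nat) (E : psheaf D r) : Prop :=
  exists (r' : nat) (r'_gt0 : (0 < r')%N),
    (r %| r')%N /\ finite_at r'_gt0 (extend r'_gt0 E).

Definition tame_weights (D : seq P1) (r : nat) (E : psheaf D r) : Prop :=
  exists (s : nat) (E' : psheaf D s) (r' : nat) (r'_gt0 : (0 < r')%N),
    [/\ (0 < s)%N, (forall p, p \in [pchar k] -> coprime s p), parabolic E',
        (r %| r')%N /\ (s %| r')%N &
        piso (extend r'_gt0 E) (extend r'_gt0 E')].

(* O(d) = O(d [oo]) *)
Definition twist (d : int) : sheaf := OX (fun x => if x == None then d else 0).

Definition sbigplus (n : nat) (F : 'I_n -> sheaf) : sheaf :=
  \big[splus/szero]_(j < n) F j.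

End ProjectiveLine.

(* Main.v *)
Require Import Defs.
From HB Require Import structures.
From mathcomp Require Import all_boot all_order all_algebra.
From mathcomp Require Import boolp classical_sets functions cardinality.
From mathcomp Require Import zify ring.

Set Implicit Arguments.
Unset Strict Implicit.
Unset Printing Implicit Defensive.

Import Order.TTheory GRing.Theory Num.Theory.
Local Open Scope classical_set_scope.
Local Open Scope ring_scope.

(** Both bounds are instances of one argument on the growth of dimensions.

Suppose that to every parabolic bundle [E] and every natural number [t] one
attaches a finite-dimensional space [G_t(E)], additive in [E], that vanishes for
[t] large, with [G_0] of the unit nonzero, and that a nonzero element of [G_1(E)]
is given such that the tensor product with it sends nonzero elements of
[G_t(E^i)] to nonzero elements of [G_(t+1)(E^(i+1))].  Then no two distinct
polynomials take isomorphic values at [E].  Indeed an isomorphism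
[P(E) ~ Q(E)] gives, for all [t], the equality of the sums of [P_i dim G_t(E^i)]
and of [Q_i dim G_t(E^i)].  If [N] is the largest degree where [P] and [Q] differ
and [t] is the largest index with [G_t(E^N)] nonzero, the terms with [i > N]
cancel and those with [i < N] vanish, hence [P_N = Q_N] ([growth_injective]).

If some [d_j] is positive, [G_t(E)] is the space of global sections of [E_0] with
a zero of order at least [t] at infinity, and the element of [G_1(E)] is the
constant section of the summand [O(d_j)] ([positive_summand]).

If some [d_j <= - m], [G_t(E)] is the space of morphisms from [E] to the parabolic
line bundle obtained from the unit by a shift of [t/r] in the weights.  The
projection of [E_0] to [O(d_j)], followed by an inclusion into [O(- D)], extends
to all of [E] because [E] is periodic up to [O(- D)]; the image of [E_a] lies in
[O(- (floor (a/r) + 1) D)], the term of index [a + 1] of the unit, and this is an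
element of [G_1(E)] ([negative_summand]).

The tensor product is known only through its universal property, so it is tested
against maps to parabolic line bundles.  Away from [D] all the terms of a
parabolic sheaf are the same, so that such a map is a family of functionals with
values in the field of rational functions that satisfies order conditions
([functional]).  Two functionals multiply to a functional on the tensor product
([functional_tensor]), and a homomorphism from [E_0] to a line bundle extends to a
functional on [E] ([functional_extends]).  A section of a locally free [E_0] is
detected by its coordinates on the generic fibre ([functional_separates]), which
gives the nonvanishing of products.  The coordinates have bounded poles
([locally_free_lattice]), which gives finite dimension and vanishing for large
[t], because a rational function with bounded poles is a polynomial of bounded
degree over a fixed denominator. *)

(** * Orders of rational functions *)

Local Notation "x %:F" := (FracField.tofrac x).

Section Orders.
Variable k : closedFieldType.
Implicit Types (x y : P1 k) (f g : ratfun k) (p q : {poly k}).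

Lemma ratfun_fracP f : exists p q, q != 0 /\ f = p%:F / q%:F.
Proof.
elim/quotW: f => -[[p q] /= q0]; exists p, q; split=> //.
apply: (canRL (mulfK _)); first by rewrite tofrac_eq0.
rewrite -[_ * _]/(FracField.mul _ _) !piE; apply/eqmodP.
rewrite /= FracField.equivfE /FracField.mulf.
by rewrite !numden_Ratio ?mul1r ?mulr1 ?oner_eq0 //= mulrC.
Qed.

Lemma ord_geN x n f : ord_ge x n f -> ord_ge x n (- f).
Proof. by move=> Hf; rewrite -sub0r; apply: ord_geB => //; exact: ord_ge0. Qed.

Lemma ord_geD x n f g : ord_ge x n f -> ord_ge x n g -> ord_ge x n (f + g).
Proof. by move=> Hf Hg; rewrite -[g]opprK; apply: ord_geB => //; exact: ord_geN. Qed.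

Lemma ord_ge_sum (I : Type) (s : seq I) (P : pred I) x n (F : I -> ratfun k) :
  (forall i, P i -> ord_ge x n (F i)) -> ord_ge x n (\sum_(i <- s | P i) F i).
Proof.
move=> HF; elim/big_ind: _ => //; first exact: ord_ge0.
by move=> f g; exact: ord_geD.
Qed.

Lemma ord_ge_expr x f (n : int) (t : nat) :
  ord_ge x n f -> ord_ge x (n * t%:Z) (f ^+ t).
Proof.
move=> Hf; elim: t => [|t IH]; first by rewrite mulr0 expr0 regularE; exact: regular_at1.
by rewrite exprS (_ : n * t.+1%:Z = n + n * t%:Z); [exact: ord_geM | lia].
Qed.

Lemma ord_ge_uniformizer x (n : int) : ord_ge x n (uniformizer x ^ n).
Proof.
rewrite /ord_ge divff ?expfz_neq0 ?uniformizer_neq0 //; exact: regular_at1.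
Qed.

Lemma regular_poly a p : regular_at (Some a) p%:F.
Proof. by exists p, 1; rewrite hornerC oner_neq0 tofrac1 divr1. Qed.

Lemma ord_ge_infty_poly p : ord_ge None (- (size p)%:Z) p%:F.
Proof.
exists p, ('X^(size p)); split; first by rewrite monic_neq0 ?monicXn.
  by rewrite size_polyXn ltnW.
by rewrite /= exprz_inv opprK tofracXn.
Qed.

Lemma ord_ge_bounded x f : exists N : nat, ord_ge x (- N%:Z) f.
Proof.
have [p [q [q0 ->]]] := ratfun_fracP f.
case: x => [a|].
  have [m [q' q'a qE]] := multiplicity_XsubC q a.
  rewrite q0 /= in q'a.
  exists m; exists p, q'; split; first by rewrite -rootE.
  rewrite qE /= -invr_expz invrK tofracM tofracXn invfM -!mulrA mulVf ?mulr1 //.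
  by rewrite expf_neq0 // tofrac_eq0 polyXsubC_eq0.
exists (size p); rewrite -[X in ord_ge _ X]addr0; apply: ord_geM.
  exact: ord_ge_infty_poly.
rewrite regularE; exists 1, q; rewrite tofrac1 div1r; split=> //.
by rewrite size_poly1 size_poly_gt0.
Qed.

(** The local rings are valuation rings: a nonunit is divisible by the uniformizer. *)
Lemma regular_inv_or_zero x f :
  regular_at x f -> ~ regular_at x f^-1 -> ord_ge x 1 f.
Proof.
case: x => [a|] [p [q]].
  case=> qa fE nf; have q0 : q != 0 by apply: contraNneq qa => ->; rewrite horner0.
  have [/factor_theorem[p' pE]|pa] := boolP (root p a); last first.
    by case: nf; exists q, p; rewrite -rootE fE invf_div.
  exists p', q; split=> //; rewrite fE pE expr1z tofracM /=.
  by rewrite mulrAC mulfK // tofrac_eq0 polyXsubC_eq0.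
case=> q0 pq fE nf; have [p0|p0] := eqVneq p 0.
  by rewrite fE p0 tofrac0 mul0r; exact: ord_ge0.
have {}pq : (size p < size q)%N.
  rewrite ltnNge; apply/negP => qp; case: nf.
  by exists q, p; split=> //; rewrite fE invf_div.
exists (p * 'X), q; split=> //; first by rewrite size_mulX.
by rewrite fE expr1z /= invrK tofracM mulrAC.
Qed.

Lemma regular_locus_cofinite f :
  finite_set (setC [set x : P1 k | regular_at x f]%classic).
Proof.
have [p [q [q0 fE]]] := ratfun_fracP f.
have [s qE] := closed_field_poly_normal q.
apply: (@sub_finite_set _ _ [set` (None :: map Some s) : seq (P1 k)]%classic);
  last exact: finite_seq.
case=> [a|] //=; rewrite inE //= => nreg; apply/mapP; exists a => //.
apply/negPn/negP => as_; apply: nreg; exists p, q; split=> //.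
by rewrite -rootE qE rootZ ?lead_coef_eq0 // root_prod_XsubC.
Qed.

Definition regular_locus f : zopen k := ZOpen (regular_locus_cofinite f).

Lemma avoid_cofinite (s : seq (P1 k)) :
  finite_set (setC [set x : P1 k | x \notin s]%classic).
Proof.
apply: (@sub_finite_set _ _ [set` s]%classic); last exact: finite_seq.
by move=> x /= /negP; rewrite negbK.
Qed.

Definition avoid (s : seq (P1 k)) : zopen k := ZOpen (avoid_cofinite s).

(** Over an algebraically closed field a nonconstant denominator has a root, where
regularity lets one cancel a linear factor. *)
Lemma entire_poly f : (forall a, regular_at (Some a) f) -> exists p, f = p%:F.
Proof.
have [p [q [q0 fE]]] := ratfun_fracP f => reg.
elim: {q}(size q) {-2}q (leqnn (size q)) p q0 fE => [|n IH] q qn p q0 fE.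
  by rewrite leqn0 size_poly_eq0 (negPf q0) in qn.
have [/size_poly1P[c c0 qE]|q1] := boolP (size q == 1).
  exists (c^-1 *: p); rewrite fE qE -mul_polyC tofracM mulrC; congr (_ * _).
  apply: (mulfI (x := c%:P%:F)); first by rewrite tofrac_eq0 polyC_eq0.
  by rewrite divff ?tofrac_eq0 ?polyC_eq0 // -tofracM -polyCM divff // tofrac1.
have [a qa] := closed_rootP q q1.
have [q' q'E] := factor_theorem _ _ qa.
have [p1 [q1' [q1a fE']]] := reg a.
have /eqP : p%:F / q%:F = p1%:F / q1'%:F :> ratfun k by rewrite -fE.
have q1'0 : q1' != 0 by apply: contraNneq q1a => ->; rewrite horner0.
rewrite eqr_div ?tofrac_eq0 // -!tofracM tofrac_eq => /eqP E.
have /factor_theorem[p' p'E] : root p a.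
  have : root (p * q1') a by rewrite E rootM qa orbT.
  by rewrite rootM => /orP[//|]; rewrite rootE (negPf q1a).
have Xa0 : 'X - a%:P != 0 :> {poly k} by rewrite polyXsubC_eq0.
have q'0 : q' != 0 by apply: contraNneq q0 => q'0; rewrite q'E q'0 mul0r.
apply: (IH q' _ p' q'0).
  by move: qn; rewrite q'E size_mul // size_XsubC addn2.
by rewrite fE p'E q'E !tofracM -mulf_div divff ?mulr1 // tofrac_eq0.
Qed.

Lemma size_poly_ord_infty p (n : nat) :
  ord_ge None (- n%:Z) p%:F -> (size p <= n.+1)%N.
Proof.
case=> p' [q' [q'0 pq]]; rewrite /= exprz_inv opprK.
have Xn0 : 'X^n != 0 :> {poly k} by rewrite monic_neq0 ?monicXn.
rewrite -exprnP -tofracXn => /eqP.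
rewrite eqr_div ?tofrac_eq0 // -!tofracM tofrac_eq => /eqP E.
have [->|p0] := eqVneq p 0; first by rewrite size_poly0.
have p'0 : p' != 0.
  apply: contraTneq isT => p'0; move: E; rewrite p'0 mul0r => /eqP.
  by rewrite mulf_eq0 (negPf p0) (negPf q'0).
move/(congr1 (fun p : {poly k} => size p)): E.
rewrite !size_mul // size_polyXn.
have arith (a b c d : nat) :
    (0 < b)%N -> (c <= b)%N -> (a + b).-1 = (c + d.+1).-1 -> (a <= d.+1)%N by lia.
by apply: arith pq; rewrite size_poly_gt0.
Qed.

Lemma ord_infty_poly_eq0 p : ord_ge None 1 p%:F -> p = 0.
Proof.
case=> p' [q' [q'0 pq]]; rewrite /= expr1z invrK -tofracM => /eqP.
have q'F : q'%:F != 0 :> ratfun k by rewrite tofrac_eq0.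
rewrite -[X in X == _]divr1 eqr_div ?oner_eq0 // mulr1 -tofracM tofrac_eq => /eqP E.
have [//|p0] := eqVneq p 0.
move/(congr1 (fun p : {poly k} => size p)): E.
rewrite size_mul ?mulf_neq0 ?polyX_eq0 // size_mulX //.
have arith (a b c : nat) :
    (0 < a)%N -> (0 < b)%N -> (c <= b)%N -> (a.+1 + b).-1 <> c by lia.
by move=> E; case: (arith _ _ _ _ _ pq E); rewrite size_poly_gt0.
Qed.

End Orders.

(** * Dimensions *)

Section Dimension.
Variable k : fieldType.

(** The zero [o] and the operation [lin c u v], read [c u + v], are explicit because
the spaces to be measured carry no structure of [k]-module: they are sets of
sections, or of families of functions indexed by open sets. *)
Definition hasdim (A : Type) (o : A) (lin : k -> A -> A -> A) (S : A -> Prop)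
    (d : nat) : Prop :=
  exists b : 'rV[k]_d -> A,
    [/\ b 0 = o, forall c u v, b (c *: u + v) = lin c (b u) (b v),
        injective b & forall a, S a <-> exists u, a = b u].

Lemma injective_linear_leq (d d' : nat) (f : 'rV[k]_d -> 'rV[k]_d') :
  linear f -> injective f -> (d <= d')%N.
Proof.
move=> flin finj.
pose F : {linear 'rV[k]_d -> 'rV[k]_d'} :=
  HB.pack f (GRing.isLinear.Build k 'rV[k]_d 'rV[k]_d' *:%R f flin).
pose M := lin1_mx F.
have fE u : f u = u *m M by rewrite (mul_rV_lin1 F).
have : row_free M.
  rewrite -kermx_eq0; apply/eqP/row_matrixP => i; rewrite row0.
  apply: finj; rewrite !fE mul0mx; apply/sub_kermxP; exact: row_sub.
by move/eqP <-; exact: rank_leq_col.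
Qed.

Variables (A : Type) (o : A) (lin : k -> A -> A -> A).
Implicit Type S : A -> Prop.

Lemma hasdim_uniq S d d' : hasdim o lin S d -> hasdim o lin S d' -> d = d'.
Proof.
suff H d1 d2 : hasdim o lin S d1 -> hasdim o lin S d2 -> (d1 <= d2)%N.
  by move=> h h'; apply/eqP; rewrite eqn_leq !H.
move=> [b [b0 blin binj bS]] [b' [b'0 b'lin b'inj b'S]].
have ex u : exists u', b u = b' u' by apply/b'S/bS; exists u.
pose f u := projT1 (cid (ex u)).
have fE u : b u = b' (f u) by rewrite /f; case: cid.
apply: (@injective_linear_leq _ _ f).
  by move=> c u v; apply: b'inj; rewrite -fE b'lin -!fE blin.
by move=> u v uv; apply: binj; rewrite !fE uv.
Qed.

Lemma hasdim_neq0 S d : hasdim o lin S d -> d != 0%N <-> exists2 a, S a & a <> o.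
Proof.
move=> [b [b0 blin binj bS]]; split=> [d0|[a /bS[u ->]] uo].
  have d_gt0 : (0 < d)%N by rewrite lt0n.
  exists (b (const_mx 1)); first by apply/bS; eexists.
  rewrite -b0 => /binj/matrixP/(_ 0 (Ordinal d_gt0)); rewrite !mxE.
  by apply/eqP; rewrite oner_neq0.
apply/eqP => d0; apply: uo; rewrite -b0; congr b.
by apply/rowP => -[i Hi]; exfalso; rewrite d0 in Hi.
Qed.

(** The image under [kap] is a subspace of a space of row vectors, and a matrix of
maximal rank with rows in a subspace spans it. *)
Lemma hasdim_embed S (N : nat) (kap : A -> 'rV[k]_N) :
  S o -> (forall c u v, S u -> S v -> S (lin c u v)) ->
  (forall c u v, S u -> S v -> kap (lin c u v) = c *: kap u + kap v) -> kap o = 0 ->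
  (forall u v, S u -> S v -> kap u = kap v -> u = v) ->
  exists d, hasdim o lin S d.
Proof.
move=> So Slin klin ko kinj.
pose good (M : 'M[k]_N) := forall u, exists2 a, S a & kap a = u *m M.
have good0 : good 0 by move=> u; exists o; rewrite // ko mulmx0.
pose P n := `[< exists2 M, good M & \rank M = n >].
have exP : exists n, P n by exists 0%N; apply/asboolP; exists 0; rewrite ?mxrank0.
have bdP n : P n -> (n <= N)%N.
  by move=> /asboolP[M _ <-]; exact: rank_leq_row.
have := ex_maxnP exP bdP; case=> d /asboolP[M gM rM] maxd.
have spanM a : S a -> (kap a <= M)%MS.
  move=> Sa; have gM' : good (M + kap a)%MS.
    move=> u; have : (u *m (M + kap a)%MS <= M + kap a)%MS by exact: submxMl.
    case/sub_addsmxP => -[u1 u2] /= ->; have [b Sb bE] := gM u1.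
    have [c ->] : exists c, u2 = c%:M by exists (u2 0 0); rewrite [LHS]mx11_scalar.
    exists (lin c a b); first exact: Slin.
    by rewrite klin // mul_scalar_mx bE addrC.
  have := maxd _ (asboolT (ex_intro2 _ _ _ gM' erefl)).
  rewrite -rM => le; apply: (submx_trans (addsmxSr M (kap a))).
  by have := mxrank_leqif_sup (addsmxSl M (kap a)) => /geq_leqif; rewrite le => /esym.
have ex u : exists a, S a /\ kap a = u *m row_base M.
  have : (u *m row_base M <= M)%MS by rewrite (submx_trans (submxMl _ _)) ?eq_row_base.
  by case/submxP => w ->; have [a Sa aE] := gM w; exists a.
pose b u := projT1 (cid (ex u)).
have Sb u : S (b u) by rewrite /b; case: cid => a [].
have bE u : kap (b u) = u *m row_base M by rewrite /b; case: cid => a [].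
exists (\rank M), b; split.
- by apply: kinj => //; rewrite bE mul0mx ko.
- move=> c u v; apply: kinj => //; first exact: Slin.
  by rewrite klin // !bE mulmxDl scalemxAl.
- move=> u v uv; have := bE u; rewrite uv bE.
  by move/(row_free_inj (row_base_free M)).
- move=> a; split=> [Sa|[u ->]] //.
  have : (kap a <= row_base M)%MS by rewrite eq_row_base spanM.
  by case/submxP => u uE; exists u; apply: kinj => //; rewrite uE bE.
Qed.

End Dimension.

Lemma hasdim_sum (k : fieldType) (A1 A2 A : Type) (o1 : A1) (o2 : A2) (o : A)
    (lin1 : k -> A1 -> A1 -> A1) (lin2 : k -> A2 -> A2 -> A2)
    (lin : k -> A -> A -> A) (S1 : A1 -> Prop) (S2 : A2 -> Prop) (S : A -> Prop)
    (tau : A1 -> A2 -> A) (d1 d2 : nat) :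
  tau o1 o2 = o ->
  (forall c u1 v1 u2 v2,
     tau (lin1 c u1 v1) (lin2 c u2 v2) = lin c (tau u1 u2) (tau v1 v2)) ->
  (forall u1 u2 v1 v2, S1 u1 -> S2 u2 -> S1 v1 -> S2 v2 ->
     tau u1 u2 = tau v1 v2 -> u1 = v1 /\ u2 = v2) ->
  (forall a, S a <-> exists a1 a2, [/\ S1 a1, S2 a2 & a = tau a1 a2]) ->
  hasdim o1 lin1 S1 d1 -> hasdim o2 lin2 S2 d2 -> hasdim o lin S (d1 + d2).
Proof.
move=> tau0 taulin tauinj tauS [b1 [b10 b1lin b1inj b1S]] [b2 [b20 b2lin b2inj b2S]].
have S1b u : S1 (b1 u) by apply/b1S; exists u.
have S2b u : S2 (b2 u) by apply/b2S; exists u.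
exists (fun u => tau (b1 (lsubmx u)) (b2 (rsubmx u))); split.
- by rewrite !linear0 b10 b20.
- by move=> c u v; rewrite !linearP b1lin b2lin taulin.
- move=> u v /(tauinj _ _ _ _ (S1b _) (S2b _) (S1b _) (S2b _))[/b1inj e1 /b2inj e2].
  by rewrite -[u]hsubmxK -[v]hsubmxK e1 e2.
- move=> a; rewrite tauS; split=> [[a1 [a2 [/b1S[u ->] /b2S[v ->] ->]]]|[u ->]].
    by exists (row_mx u v); rewrite row_mxKl row_mxKr.
  by exists (b1 (lsubmx u)), (b2 (rsubmx u)).
Qed.

Lemma hasdim_iso (k : fieldType) (A A' : Type) (o : A) (o' : A')
    (lin : k -> A -> A -> A) (lin' : k -> A' -> A' -> A') (S : A -> Prop)
    (S' : A' -> Prop) (tau : A -> A') (sig : A' -> A) (d : nat) :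
  tau o = o' -> (forall c u v, tau (lin c u v) = lin' c (tau u) (tau v)) ->
  cancel tau sig -> cancel sig tau ->
  (forall a, S a -> S' (tau a)) -> (forall a, S' a -> S (sig a)) ->
  hasdim o lin S d -> hasdim o' lin' S' d.
Proof.
move=> tau0 taulin tK sK SS' S'S [b [b0 blin binj bS]].
exists (tau \o b); split=> /=.
- by rewrite b0.
- by move=> c u v; rewrite blin taulin.
- by apply: inj_comp binj; exact: can_inj tK.
- move=> a; split=> [/S'S/bS[u uE]|[u ->]]; first by exists u; rewrite -uE sK.
  by apply/SS'/bS; eexists.
Qed.

Lemma hasdim0 (k : fieldType) (A : Type) (o : A) (lin : k -> A -> A -> A)
    (S : A -> Prop) :
  (forall c, lin c o o = o) -> (forall a, S a <-> a = o) -> hasdim o lin S 0.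
Proof.
move=> linoo So; exists (fun=> o); split=> //.
- by move=> u v _; rewrite [u]thinmx0 [v]thinmx0.
- by move=> a; rewrite So; split=> [->|[_ ->]] //; exists 0.
Qed.

(** * Sections of locally free sheaves in coordinates *)

Section Sheaves.
Variable k : closedFieldType.
Implicit Types (F G : sheaf k) (U V W : zopen k) (x y : P1 k).

Lemma zcapl U V : zcap U V `<=` U. Proof. by move=> x []. Qed.
Lemma zcapr U V : zcap U V `<=` V. Proof. by move=> x []. Qed.
Lemma zsub_refl U : U `<=` U. Proof. by []. Qed.
Lemma zsub_full U : U `<=` zfull k. Proof. by []. Qed.

Lemma regvalM U (a b : regfun U) : regval (a * b) = regval a * regval b.
Proof. by []. Qed.
Lemma regvalX U (a : regfun U) n : regval (a ^+ n) = regval a ^+ n.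
Proof. by elim: n => [|n IH] //; rewrite !exprS regvalM IH. Qed.

Lemma regular_constant U (c : k) : c%:P%:F \in regular U.
Proof.
apply/asboolP => -[a|] _; first exact: regular_poly.
exists c%:P, 1; split; rewrite ?oner_eq0 ?tofrac1 ?divr1 //.
by rewrite size_poly1 size_polyC_leq1.
Qed.

Definition constant U (c : k) : regfun U := RegFun (regular_constant U c).

Section Restriction.
Variables (F : sheaf k) (U V : zopen k) (h : V `<=` U).

Lemma res0 : res h (0 : F U) = 0.
Proof.
have := res_lin h (-1) 0 (0 : F U); rewrite scaler0 addr0.
have -> : rres h (-1) = -1 by exact/val_inj.
by rewrite scaleN1r addNr.
Qed.

Lemma resZ a (s : F U) : res h (a *: s) = rres h a *: res h s.
Proof. by have := res_lin h a s 0; rewrite res0 !addr0. Qed.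

Lemma resD (s t : F U) : res h (s + t) = res h s + res h t.
Proof.
have := res_lin h 1 s t; have -> : rres h 1 = 1 by exact/val_inj.
by rewrite !scale1r.
Qed.

Lemma resB (s t : F U) : res h (s - t) = res h s - res h t.
Proof.
by rewrite resD; congr (_ + _); apply/eqP; rewrite -addr_eq0 -resD addNr res0.
Qed.

Lemma res_sum (I : finType) (s : I -> F U) :
  res h (\sum_i s i) = \sum_i res h (s i).
Proof. by elim/big_rec2: _ => [|i v t _ <-]; [exact: res0 | exact: resD]. Qed.
End Restriction.

Lemma res_res F U V W (h : V `<=` U) (h' : W `<=` V) (h'' : W `<=` U) (s : F U) :
  res h' (res h s) = res h'' s.
Proof. exact: res_comp. Qed.

Lemma smap0 F G (f : smor F G) U : f U 0 = 0.
Proof.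
by have := @smap_lin _ _ _ f U (-1) 0 0; rewrite scaler0 addr0 scaleN1r addNr.
Qed.

Lemma smapZ F G (f : smor F G) U (a : regfun U) (s : F U) : f U (a *: s) = a *: f U s.
Proof. by have := @smap_lin _ _ _ f U a s 0; rewrite smap0 !addr0. Qed.

Lemma bimap0l F G H (f : bimor F G H) U (t : G U) : f U 0 t = 0.
Proof.
have := @bimap_linl _ _ _ _ f U t (-1) 0 0.
by rewrite scaler0 addr0 scaleN1r addNr.
Qed.

Lemma bimapZ F G H (f : bimor F G H) U (a b : regfun U) (s : F U) (t : G U) :
  f U (a *: s) (b *: t) = (a * b) *: f U s t.
Proof.
have := @bimap_linl _ _ _ _ f U (b *: t) a s 0; rewrite bimap0l !addr0 => ->.
have f0 : f U s 0 = 0.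
  by have := @bimap_linr _ _ _ _ f U s (-1) 0 0; rewrite scaler0 addr0 scaleN1r addNr.
have := @bimap_linr _ _ _ _ f U s b t 0; rewrite f0 !addr0 => ->.
by rewrite scalerA.
Qed.

Definition is_frame F U n (e : 'I_n -> F U) : Prop :=
  forall V (h : V `<=` U) (s : F V),
  exists! c : {ffun 'I_n -> regfun V}, s = \sum_i c i *: res h (e i).

Lemma frame_uniq F U n (e : 'I_n -> F U) V (h : V `<=` U)
    (c c' : 'I_n -> regfun V) : is_frame e ->
  \sum_i c i *: res h (e i) = \sum_i c' i *: res h (e i) -> c =1 c'.
Proof.
move=> fe cc' i.
have [c0 [_ c0U]] := fe V h (\sum_i c i *: res h (e i)).
have /(congr1 (fun f : {ffun _ -> _} => f i)) : c0 = [ffun i => c i].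
  by apply: c0U => /=; under [RHS]eq_bigr do rewrite ffunE.
have /(congr1 (fun f : {ffun _ -> _} => f i)) : c0 = [ffun i => c' i].
  by apply: c0U => /=; rewrite cc'; under [RHS]eq_bigr do rewrite ffunE.
by rewrite !ffunE => -> ->.
Qed.

(** Coefficients over a frame are rational functions, which a smaller open set
determines; hence restriction of sections of a locally free sheaf is injective. *)
Lemma locally_free_res_inj F U W (h : W `<=` U) (s t : F U) :
  locally_free F -> res h s = res h t -> s = t.
Proof.
move=> lf st; apply/eqP; rewrite -subr_eq0; apply/eqP.
have {st} : res h (s - t) = 0 by rewrite resB st subrr.
move: (s - t) => {s t} s s0.
pose C := [set V : zopen k | V `<=` U /\
  exists U' n (e : 'I_n -> F U'), V `<=` U' /\ is_frame e]%classic.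
apply: (sheaf_sep (C := C)) => [V []//|x Ux|V hV [_ [U' [n [e [hV' fe]]]]]].
  have [U' U'x [n [e fe]]] := lf x.
  exists (zcap U U') => //; split; first exact: zcapl.
  by exists U', n, e; split=> //; exact: zcapr.
rewrite res0; have [c [sE _]] := fe V hV' (res hV s).
have h1 : zcap V W `<=` V := @zcapl V W.
have h2 : zcap V W `<=` U' by move=> x [/hV'].
have : \sum_i rres h1 (c i) *: res h2 (e i) = \sum_i 0 *: res h2 (e i).
  rewrite [RHS]big1 => [|i _]; last by rewrite scale0r.
  have h3 : zcap V W `<=` U by move=> x [/hV].
  transitivity (res (@zcapr V W) (res h s)); last by rewrite s0 res0.
  rewrite (res_res _ _ h3) -(res_res hV h1 h3) sE res_sum.
  by apply: eq_bigr => i _; rewrite resZ (res_res _ _ h2).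
move/frame_uniq => /(_ fe) cE; rewrite sE big1 // => i _.
have -> : c i = 0 by apply/val_inj; exact: (congr1 (@regval _ _) (cE i)).
by rewrite scale0r.
Qed.

(** The data of a locally free sheaf inside its generic fibre: [gc] gives the
coordinates of sections in a basis of the generic fibre, and the stalk at [x]
lies between [pi^N] and [pi^-N] times the lattice that this basis spans. *)
Record lattice F n (gc : forall U, F U -> 'rV[ratfun k]_n) (N : P1 k -> nat) :
    Prop := Lattice {
  lattice_lin : forall U (a : regfun U) (s t : F U),
    gc U (a *: s + t) = regval a *: gc U s + gc U t;
  lattice_res : forall U V (h : V `<=` U) (s : F U), gc V (res h s) = gc U s;
  lattice_inj : forall U (s t : F U), gc U s = gc U t -> s = t;
  lattice_support : exists r : seq (P1 k), forall x, x \notin r -> N x = 0%N;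
  lattice_pole : forall U (s : F U) x j, zset U x ->
    ord_ge x (- (N x)%:Z) (gc U s 0 j);
  lattice_basis : forall x j, exists (U : zopen k) (s : F U), zset U x /\
    gc U s = uniformizer x ^+ N x *: delta_mx 0 j }.

Lemma ord_ge_bounded_fin (I : finType) x (f : I -> ratfun k) :
  exists N : nat, forall i, ord_ge x (- N%:Z) (f i).
Proof.
have /choice[N HN] i : exists N : nat, ord_ge x (- N%:Z) (f i).
  exact: ord_ge_bounded.
exists (\max_i N i); move=> i; apply: ord_ge_le (HN i).
by rewrite lerN2 lez_nat leq_bigmax.
Qed.

Lemma zbigcap_cofinite (I : finType) (U : I -> zopen k) :
  finite_set (setC [set x : P1 k | forall i, zset (U i) x]%classic).
Proof.
apply: (@sub_finite_set _ _
  (\bigcup_(i in [set: I]) setC (zset (U i)))%classic).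
  by move=> x /= /existsNP[i ni]; exists i.
by apply: bigcup_finite => // i _; exact: zset_cofinite.
Qed.

Definition zbigcap (I : finType) (U : I -> zopen k) : zopen k :=
  ZOpen (zbigcap_cofinite U).

Section GenericCoordinates.
Variables (F : sheaf k) (lf : locally_free F).
Variables (U0 : zopen k) (n : nat) (e : 'I_n -> F U0) (fe : is_frame e).

(** The coordinates over [U] and [U0] together are the restrictions of one vector of
rational functions, which thus knows the coordinates on every smaller open set. *)
Let coord_ex U (s : F U) : exists v : 'rV[ratfun k]_n,
  forall W (h : W `<=` U) (h0 : W `<=` U0) (c : 'I_n -> regfun W),
  res h s = \sum_i c i *: res h0 (e i) <-> forall i, v 0 i = regval (c i).
Proof.
have [c [sE _]] := fe (@zcapr U U0) (res (@zcapl U U0) s).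
exists (\row_i regval (c i)) => W h h0 c'.
have hW : W `<=` zcap U U0 by move=> x Wx; split; [exact: h | exact: h0].
have {}sE : res h s = \sum_i rres hW (c i) *: res h0 (e i).
  rewrite -(res_res (@zcapl U U0) hW h) sE res_sum; apply: eq_bigr => i _.
  by rewrite resZ (res_res _ _ h0).
rewrite sE; split=> [cc' i|cc'].
  rewrite mxE; have := frame_uniq fe cc' i.
  by move/(congr1 (@regval _ _)).
apply: eq_bigr => i _; congr (_ *: _); apply/val_inj.
by rewrite /= -cc' mxE.
Qed.

Definition gcoord U (s : F U) : 'rV[ratfun k]_n := projT1 (cid (coord_ex s)).

Lemma gcoordP U (s : F U) W (h : W `<=` U) (h0 : W `<=` U0) (c : 'I_n -> regfun W) :
  res h s = \sum_i c i *: res h0 (e i) <-> forall i, gcoord s 0 i = regval (c i).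
Proof. by rewrite /gcoord; case: cid => v Hv; exact: Hv. Qed.

Lemma gcoord_regular U (s : F U) W : W `<=` U -> W `<=` U0 ->
  exists c : 'I_n -> regfun W, forall i, gcoord s 0 i = regval (c i).
Proof.
move=> h h0; have [c [/(gcoordP _ h h0) sE _]] := fe h0 (res h s).
by exists c.
Qed.

Lemma gcoord_lin U (a : regfun U) (s t : F U) :
  gcoord (a *: s + t) = regval a *: gcoord s + gcoord t.
Proof.
have h := @zcapl U U0; have h0 := @zcapr U U0.
have [c cE] := gcoord_regular s h h0; have [d dE] := gcoord_regular t h h0.
apply/rowP => i; rewrite mxE mxE cE dE.
rewrite -[RHS]/(regval (rres h a * c i + d i)); move: i.
apply/(gcoordP _ h h0).
rewrite res_lin (proj2 (gcoordP s h h0 c) cE) (proj2 (gcoordP t h h0 d) dE).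
rewrite scaler_sumr -big_split; apply: eq_bigr => i _.
by rewrite scalerDl scalerA.
Qed.

Lemma gcoord_res U V (h : V `<=` U) (s : F U) : gcoord (res h s) = gcoord s.
Proof.
have hV := @zcapl V U0; have h0 := @zcapr V U0.
have hU : zcap V U0 `<=` U by move=> x [/h].
have [c cE] := gcoord_regular s hU h0.
apply/rowP => i; rewrite cE; move: i; apply/(gcoordP _ hV h0).
by rewrite (res_res _ _ hU); apply/gcoordP.
Qed.

Lemma gcoord_inj U (s t : F U) : gcoord s = gcoord t -> s = t.
Proof.
move=> st; have h := @zcapl U U0; have h0 := @zcapr U U0.
have [c cE] := gcoord_regular s h h0.
apply: (locally_free_res_inj (h := h)) => //.
rewrite (proj2 (gcoordP s h h0 c) cE); apply/esym.
by rewrite gcoordP -st.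
Qed.

Lemma gcoord_basis j : gcoord (e j) = delta_mx 0 j.
Proof.
apply/rowP => i; rewrite mxE eqxx /=.
have -> : ((i == j)%:R : ratfun k) = regval ((i == j)%:R : regfun U0).
  by case: eqP.
move: i; apply/(gcoordP _ (@zsub_refl U0) (@zsub_refl U0)).
rewrite (bigD1 j) //= eqxx scale1r big1 ?addr0 // => i /negPf ->.
by rewrite scale0r.
Qed.

Lemma gcoord0 U : gcoord (0 : F U) = 0.
Proof.
have := gcoord_lin (-1) 0 (0 : F U); rewrite scaler0 addr0 => ->.
by rewrite (_ : regval (-1) = -1) // scaleN1r addNr.
Qed.

Lemma gcoord_sum (I : finType) U (c : I -> regfun U) (s : I -> F U) :
  gcoord (\sum_i c i *: s i) = \sum_i regval (c i) *: gcoord (s i).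
Proof.
elim/big_rec2: _ => [|i v t _ <-]; [exact: gcoord0 | exact: gcoord_lin].
Qed.

(** The stalk at [x] lies between [pi^N] and [pi^-N] times the span of the frame. *)
Definition pole_order_at x (N : nat) : Prop :=
  (forall U (s : F U) j, zset U x -> ord_ge x (- N%:Z) (gcoord s 0 j)) /\
  (forall j, exists (U : zopen k) (s : F U), zset U x /\
     gcoord s = uniformizer x ^+ N *: delta_mx 0 j).

Lemma pole_order_on_frame x : zset U0 x -> pole_order_at x 0.
Proof.
move=> U0x; split=> [U s j Ux|j]; last first.
  by exists U0, (e j); rewrite expr0 scale1r gcoord_basis.
have [c ->] := gcoord_regular s (@zcapl U U0) (@zcapr U U0).
by rewrite oppr0 regularE; have /asboolP := regvalP (c j); apply; split.
Qed.

(** Passing between two frames costs only finitely many orders of pole. *)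
Lemma pole_order_exists x : exists N, pole_order_at x N.
Proof.
have [U1 U1x [n1 [e1 fe1]]] := lf x.
have [N1 HN1] := ord_ge_bounded_fin x
  (fun ij : 'I_n1 * 'I_n => gcoord (e1 ij.1) 0 ij.2).
have h0 := @zcapl U0 U1; have h1 := @zcapr U0 U1.
have /choice[b bE] (j : 'I_n) : exists c : 'I_n1 -> regfun (zcap U0 U1),
    res h0 (e j) = \sum_i c i *: res h1 (e1 i).
  by have [c [? _]] := fe1 _ h1 (res h0 (e j)); exists c.
have [N2 HN2] := ord_ge_bounded_fin x
  (fun ij : 'I_n1 * 'I_n => regval (b ij.2 ij.1)).
exists (N1 + N2)%N; split=> [U s j Ux|j].
  have h := @zcapl U U1; have h' := @zcapr U U1.
  have [c [sE _]] := fe1 _ h' (res h s).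
  rewrite -(gcoord_res h s) sE gcoord_sum summxE; apply: ord_ge_sum => i _.
  rewrite mxE gcoord_res.
  apply: (@ord_ge_le _ _ _ (0 + - N1%:Z)); first by lia.
  apply: ord_geM; last exact: (HN1 (i, j)).
  by rewrite regularE; have /asboolP := regvalP (c i); apply; split.
pose f i := uniformizer x ^+ (N1 + N2) * regval (b j i).
have freg i : regular_at x (f i).
  rewrite -regularE; apply: (@ord_ge_le _ _ _ ((N1 + N2)%:Z + - N2%:Z)); first by lia.
  apply: ord_geM; last exact: (HN2 (i, j)).
  exact: ord_ge_uniformizer.
pose W := zcap U1 (zbigcap (fun i => regular_locus (f i))).
have fW i : f i \in regular W by apply/asboolP => y [_]; exact.
exists W, (\sum_i RegFun (fW i) *: res (@zcapl _ _) (e1 i)); split; first by split.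
rewrite gcoord_sum -gcoord_basis -(gcoord_res h0) bE gcoord_sum scaler_sumr.
by apply: eq_bigr => i _; rewrite /= !gcoord_res scalerA.
Qed.

End GenericCoordinates.

Lemma locally_free_lattice F : locally_free F ->
  exists n gc N, @lattice F n gc N.
Proof.
move=> lf; have [U0 _ [n [e fe]]] := lf None.
have /choice[N HN] x : exists N, pole_order_at fe x N /\ (zset U0 x -> N = 0%N).
  have [U0x|nU0x] := pselect (zset U0 x).
    by exists 0%N; split=> //; exact: pole_order_on_frame.
  by have [N HN] := pole_order_exists lf fe x; exists N.
exists n, (gcoord fe), N; split.
- exact: gcoord_lin.
- exact: gcoord_res.
- exact: gcoord_inj.
- have /finite_seqP[s sE] := zset_cofinite U0.
  exists s => x xs; apply: (proj2 (HN x)); apply: contrapT => nU0.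
  have : (~` zset U0)%classic x by [].
  by rewrite sE /= (negPf xs).
- by move=> U s x j; have [[pole _] _] := HN x; exact: pole.
- by move=> x; have [[_ basis] _] := HN x.
Qed.

End Sheaves.

(** * Parabolic line bundles and functionals *)

Section Functionals.
Variable k : closedFieldType.
Implicit Types (U V W : zopen k) (x y : P1 k) (delta : P1 k -> int).

Lemma osec_ord delta U (f : OX delta U) x : zset U x -> ord_ge x (- delta x) (osecval f).
Proof. by move=> Ux; have /asboolP := osecvalP f; exact. Qed.

Lemma regfun_ord U (a : regfun U) x : zset U x -> ord_ge x 0 (regval a).
Proof. by move=> Ux; rewrite regularE; have /asboolP := regvalP a; exact. Qed.

(** At the finitely many points of [U] outside of the open set where [f] is
invertible, [f] vanishes, so that its powers absorb the poles of a section. *)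
Lemma OX_quasi_coherent delta : quasi_coherent (OX delta).
Proof.
move=> U V h f VE; split=> [s s0|t].
  by exists 0%N; rewrite expr0 scale1r; apply/val_inj; exact: (congr1 val s0).
have f0 : regval f != 0 by have [x] := zopen_nonempty V; rewrite VE => -[].
have /choice[M HM] x : exists M : nat, ord_ge x (- M%:Z) (osecval t).
  exact: ord_ge_bounded.
have /finite_seqP[r rE] := zset_cofinite V.
pose N := (\max_(x <- r) (M x + `|delta x|))%N.
have P : regval f ^+ N * osecval t \in osec_pred delta U.
  apply/asboolP => x Ux; have fx := regfun_ord f Ux.
  have [Vx|nVx] := pselect (zset V x).
    rewrite -[- _](@add0r int) -(@mul0r int N%:Z); apply: ord_geM; last exact: osec_ord.
    exact: ord_ge_expr.
  have {}fx : ord_ge x 1 (regval f).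
    apply: regular_inv_or_zero; first by rewrite -regularE.
    by move=> ifx; apply: nVx; rewrite VE.
  have xr : x \in r by have : (~` zset V)%classic x by []; rewrite rE.
  have le : (M x + `|delta x| <= N)%N by exact: leq_bigmax_seq.
  apply: (@ord_ge_le _ _ _ (1 * N%:Z + - (M x)%:Z)); first by lia.
  by apply: ord_geM; [exact: ord_ge_expr | exact: HM].
exists N, (OSec P); apply/val_inj => /=.
by rewrite -[RHS]/(regval (rres h f ^+ N) * osecval t) regvalX.
Qed.

Section Level.
Variables (D : seq (P1 k)) (r : nat) (r_gt0 : (0 < r)%N).

Lemma ceil1_leP (i c : int) : (ceil_index 1 r i <= c) = (i <= c * r%:Z).
Proof.
rewrite /ceil_index mulr1.
have r0 : r%:Z != 0 by rewrite eqz_nat -lt0n.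
have r_pos : 0 < r%:Z by rewrite ltz_nat.
have := divz_eq (- i) r%:Z; have := modz_ge0 (- i) r0.
have := ltz_pmod (- i) r_pos; set q := (- i %/ r%:Z)%Z; set m := (- i %% r%:Z)%Z.
move=> m_lt m_ge E; apply/idP/idP; nia.
Qed.

Lemma ceil1_gtP (i c : int) : (c < ceil_index 1 r i) = (c * r%:Z < i).
Proof. by rewrite ltNge ceil1_leP -ltNge. Qed.

Lemma ceil1_add (i j : int) :
  ceil_index 1 r (i + j) <= ceil_index 1 r i + ceil_index 1 r j.
Proof.
by rewrite ceil1_leP mulrDl lerD // -ceil1_leP.
Qed.

Lemma divisor_ge0 x : 0 <= divisor D x. Proof. by []. Qed.

Definition pline_div delta (t a : int) x : int :=
  delta x - ceil_index 1 r (a + t) * divisor D x.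

Lemma pline_le delta t (a a' : int) (le : a <= a') x :
  pline_div delta t a' x <= pline_div delta t a x.
Proof.
by rewrite lerD2l lerN2 ler_wpM2r // ceil_index_le // lerD2r.
Qed.

Lemma pline_shift delta t (a a' : int) (e : a' = a + r%:Z) x :
  pline_div delta t a' x = pline_div delta t a x + - divisor D x.
Proof.
rewrite /pline_div (@ceil_index_shift 1 r (a + t)) //; last by rewrite e addrAC.
by rewrite mulrDl mul1r opprD addrA.
Qed.

(** The parabolic line bundle obtained from the unit by a shift of [t/r] in the
weights and a twist by the divisor [delta]. *)
Definition pline delta (t : int) : psheaf D r.
Proof.
refine (@PSheaf k D r (fun a => OX (pline_div delta t a))
  (fun a a' le => OX_incl (pline_le delta t le)) _ _
  (fun a a' e => OX_mul (pline_shift delta t e)) _ _ _).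
- by move=> i le U s; apply/val_inj.
- by move=> i i' i'' le le' le'' U s; apply/val_inj.
- move=> i i' e U f /ideal_generatorP[f0 fV].
  have P (s : OX (pline_div delta t i') U) :
      osecval s / osecval f \in osec_pred (pline_div delta t i) U.
    apply/asboolP => x Ux.
    have -> : - pline_div delta t i x = - pline_div delta t i' x + - divisor D x.
      by rewrite (pline_shift delta t e); lia.
    by apply: ord_geM; [exact: osec_ord | exact: fV].
  exists (fun s => OSec (P s)) => s; apply/val_inj => /=.
    by rewrite mulfK.
  by rewrite divfK.
- by move=> i1 i2 i1' i2' e1 e2 le le' U s f; apply/val_inj.
- by move=> i i' e le U s f; apply/val_inj; rewrite /= mulrC.
Defined.

(** Morphisms from [E] to [pline delta t], as families of maps with values in the
field of rational functions. *)
Record functional (E : psheaf D r) delta (t : int)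
    (phi : forall (a : int) U, E a U -> ratfun k) : Prop := Functional {
  functional_lin : forall a U (c : regfun U) (s s' : E a U),
    phi a U (c *: s + s') = regval c * phi a U s + phi a U s';
  functional_res : forall a U V (h : V `<=` U) (s : E a U),
    phi a V (res h s) = phi a U s;
  functional_trans : forall (a a' : int) (le : a <= a') U (s : E a' U),
    phi a U (trans E le U s) = phi a' U s;
  functional_jmap : forall (a a' : int) (e : a' = a + r%:Z) U (s : E a U)
    (f : Oideal D U), phi a' U (jmap E e U s f) = phi a U s * osecval f;
  functional_ord : forall (a : int) U (s : E a U) x, zset U x ->
    ord_ge x (- pline_div delta t a x) (phi a U s) }.

Lemma functional_of_pmor (E : psheaf D r) delta t (f : pmor E (pline delta t)) :
  @functional E delta t (fun a U s => osecval (f a U s)).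
Proof.
split.
- by move=> a U c s s'; rewrite smap_lin.
- by move=> a U V h s; rewrite smap_res.
- by move=> a a' le U s; rewrite pmap_trans.
- by move=> a a' e U s g; rewrite pmap_jmap.
- by move=> a U s x; exact: osec_ord.
Qed.

Section FunctionalTheory.
Variables (E : psheaf D r) (delta : P1 k -> int) (t : int).
Variables (phi : forall (a : int) U, E a U -> ratfun k).
Hypothesis phiP : functional delta t phi.

Lemma functional0 a U : @phi a U 0 = 0.
Proof.
have := functional_lin phiP (-1) (0 : E a U) 0.
by rewrite scaler0 addr0 (_ : regval (-1) = -1) // mulN1r addNr.
Qed.

End FunctionalTheory.

(** The condition on [p] in the definition of the tensor product. *)
Definition universal_pairing (E E' T : psheaf D r) (p : pairing E E' T) : Prop :=
  forall E'' : psheaf D r, (forall i, quasi_coherent (E'' i)) ->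
  forall q : pairing E E' E'',
  (exists f : pmor T E'', forall a b U (s : E a U) (t : E' b U),
     f (a + b) U (p a b U s t) = q a b U s t) /\
  (forall f f' : pmor T E'',
     (forall a b U (s : E a U) (t : E' b U),
        f (a + b) U (p a b U s t) = f' (a + b) U (p a b U s t)) ->
     forall i U (s : T i U), f i U s = f' i U s).

(** The product of two functionals is a pairing, and factors through the tensor
product; rounding up is subadditive, so that weights add up. *)
Lemma functional_tensor (E E' T : psheaf D r) (p : pairing E E' T)
    delta delta' (t t' : int) phi phi' :
  universal_pairing p -> @functional E delta t phi -> @functional E' delta' t' phi' ->
  exists2 psi, @functional T (fun x => delta x + delta' x) (t + t') psi &
    forall a b U (s : E a U) (s' : E' b U),
      psi (a + b) U (p a b U s s') = phi a U s * phi' b U s'.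
Proof.
move=> up [flin fres ftrans fjmap ford] [flin' fres' ftrans' fjmap' ford'].
pose L := pline (fun x => delta x + delta' x) (t + t').
have P a b U (s : E a U) (s' : E' b U) : phi a U s * phi' b U s' \in
    osec_pred (pline_div (fun x => delta x + delta' x) (t + t') (a + b)) U.
  apply/asboolP => x Ux.
  apply: ord_ge_le (ord_geM (ford a U s x Ux) (ford' b U s' x Ux)).
  have := ler_wpM2r (divisor_ge0 x) (ceil1_add (a + t) (b + t')).
  rewrite addrACA mulrDl.
  have arith (A B C d d' : int) : A <= B + C -> - (d + d' - A) <= - (d - B) - (d' - C).
    by lia.
  exact: arith.
pose m a b U (s : E a U) (s' : E' b U) : L (a + b) U := OSec (P a b U s s').
have ml a b U (s' : E' b U) : linear (fun s : E a U => m a b U s s').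
  by move=> c s1 s2; apply/val_inj; rewrite /= flin mulrDl mulrA.
have mr a b U (s : E a U) : linear (m a b U s).
  by move=> c s1 s2; apply/val_inj; rewrite /= flin' mulrDr mulrCA.
have mres a b U V (h : V `<=` U) (s : E a U) (s' : E' b U) :
    m a b V (res h s) (res h s') = res h (m a b U s s').
  by apply/val_inj; rewrite /= fres fres'.
pose q0 a b : bimor (E a) (E' b) (L (a + b)) := BiMor (ml a b) (mr a b) (mres a b).
have q : exists q : pairing E E' L, forall a b U s s',
    osecval (q a b U s s') = phi a U s * phi' b U s'.
  unshelve eexists (@Pairing k D r E E' L q0 _ _ _ _) => //.
  - by move=> a a' b le le' U s s'; apply/val_inj; rewrite /= ftrans.
  - by move=> a b b' le le' U s s'; apply/val_inj; rewrite /= ftrans'.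
  - by move=> a a' b e e' U s s' f; apply/val_inj; rewrite /= fjmap mulrAC.
  - by move=> a b b' e e' U s s' f; apply/val_inj; rewrite /= fjmap' mulrA.
have [{}q qE] := q.
have [[f fE] _] := up L (fun i => OX_quasi_coherent _) q.
exists (fun a U s => osecval (f a U s)); first exact: functional_of_pmor.
by move=> a b U s s'; rewrite fE qE.
Qed.

Lemma ideal_generatorI U (f : Oideal D U) : osecval f != 0 ->
  (forall x, zset U x -> ord_ge x (- divisor D x) (osecval f)^-1) ->
  ideal_generator f.
Proof.
move=> f0 fV V h g.
have P : osecval g / osecval f \in regular V.
  apply/asboolP => x Vx; rewrite -regularE -[0](subrr (divisor D x)).
  apply: ord_geM; last by apply: fV; exact: h.
  by rewrite -[divisor D x]opprK; exact: osec_ord.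
by exists (RegFun P); apply/val_inj; rewrite /= divfK.
Qed.

(** The power of the uniformizer with the right order at [x] generates near [x], once
the other points where it is not a unit and the other points of [D] are removed. *)
Lemma local_ideal_generator x :
  exists U (f : Oideal D U), zset U x /\ ideal_generator f.
Proof.
pose p := uniformizer x ^ divisor D x.
pose W := zcap (zcap (regular_locus p) (regular_locus p^-1)) (avoid D).
have fin : finite_set (setC [set y : P1 k | y = x \/ zset W y]%classic).
  apply: sub_finite_set (zset_cofinite W) => y /= /not_orP[] //.
pose U := ZOpen fin.
have p0 : p != 0 by rewrite expfz_neq0 // uniformizer_neq0.
have away y : zset W y -> divisor D y = 0.
  by move=> [_ /= yD]; rewrite /divisor (count_memPn yD).
have pP : p \in osec_pred (fun y => - divisor D y) U.
  apply/asboolP => y; rewrite opprK => -[->|Wy]; first exact: ord_ge_uniformizer.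
  by rewrite away // regularE; have [[]] := Wy.
exists U, (OSec pP); split; first by left.
apply: ideal_generatorI => //= y [->|Wy].
  by rewrite /p invr_expz; exact: ord_ge_uniformizer.
by rewrite away // oppr0 regularE; have [[]] := Wy.
Qed.

Lemma one_ideal W : W `<=` avoid D -> 1 \in osec_pred (fun x => - divisor D x) W.
Proof.
move=> hW; apply/asboolP => x /hW /= xD; rewrite opprK.
by rewrite /divisor (count_memPn xD) regularE; exact: regular_at1.
Qed.

(** Away from [D] the ideal of [D] is trivial and periodicity identifies all the
terms of a parabolic sheaf with each other. *)
Section AwayFromD.
Variables (E : psheaf D r) (W : zopen k) (hW : W `<=` avoid D).

Let one : Oideal D W := OSec (one_ideal hW).

Let one_scale a (u : E a W) : ideal_val one *: u = u.
Proof. by rewrite -[RHS]scale1r; congr (_ *: _); exact/val_inj. Qed.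

(** Multiplication by the section 1 of the trivial ideal of [D] goes from index [a] to
[a + r] and is a right inverse of the transition map. *)
Lemma trans_surj_away (a b : int) (le : a <= b) (u : E a W) :
  exists v : E b W, trans E le W v = u.
Proof.
have step N (c : int) (cE : c = a + N%:Z * r%:Z) (lec : a <= c) :
    exists v : E c W, trans E lec W v = u.
  elim: N c cE lec => [|N IH] c cE lec.
    have {}cE : c = a by rewrite cE mul0r addr0.
    by subst c; exists u; rewrite trans_id.
  have le' : a <= a + N%:Z * r%:Z by nia.
  have [v vE] := IH _ erefl le'.
  have e : c = (a + N%:Z * r%:Z) + r%:Z by rewrite cE intS mulrDl mul1r addrCA addrC.
  have lec' : a + N%:Z * r%:Z <= c by nia.
  exists (jmap E e W v one).
  by rewrite -(trans_comp le' lec' lec) jmap_trans one_scale.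
have lec : a <= a + `|b - a|%:Z * r%:Z by nia.
have leb : b <= a + `|b - a|%:Z * r%:Z by nia.
have [v vE] := step _ _ erefl lec.
by exists (trans E leb W v); rewrite (trans_comp le leb lec).
Qed.

(** By naturality of the periodicity it is a left inverse as well. *)
Lemma trans_inj_away (a b : int) (le : a <= b) (u v : E b W) :
  trans E le W u = trans E le W v -> u = v.
Proof.
have step (c c' : int) (cE : c' = c + r%:Z) (lec : c <= c') (u' v' : E c' W) :
    trans E lec W u' = trans E lec W v' -> u' = v'.
  have cancelJ (w : E c' W) : jmap E cE W (trans E lec W w) one = w.
    have lec' : c' <= c' + r%:Z by lia.
    by rewrite -(jmap_natural cE erefl lec lec') jmap_trans one_scale.
  by move=> uv; rewrite -[u']cancelJ -[v']cancelJ uv.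
have stepn N (c : int) (cE : c = a + N%:Z * r%:Z) (lec : a <= c) (u' v' : E c W) :
    trans E lec W u' = trans E lec W v' -> u' = v'.
  elim: N c cE lec u' v' => [|N IH] c cE lec u' v'.
    have {}cE : c = a by rewrite cE mul0r addr0.
    by subst c; rewrite !trans_id.
  have le' : a <= a + N%:Z * r%:Z by nia.
  have e : c = (a + N%:Z * r%:Z) + r%:Z by rewrite cE intS mulrDl mul1r addrCA addrC.
  have lec' : a + N%:Z * r%:Z <= c by nia.
  by rewrite -!(trans_comp le' lec' lec) => /(IH _ erefl)/(step _ _ e).
have lec : a <= a + `|b - a|%:Z * r%:Z by nia.
have leb : b <= a + `|b - a|%:Z * r%:Z by nia.
have [u' <-] := trans_surj_away leb u; have [v' <-] := trans_surj_away leb v.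
by rewrite !(trans_comp le leb lec) => /(stepn _ _ erefl) ->.
Qed.

End AwayFromD.

Section Extension.
Variables (E : psheaf D r) (delta : P1 k -> int) (lam : smor (E 0) (OX delta)).

Let lam_val U (s : E 0 U) : ratfun k := osecval (lam U s).

Let lam_res U V (h : V `<=` U) (s : E 0 U) : lam_val (res h s) = lam_val s.
Proof. by rewrite /lam_val smap_res. Qed.

(** Away from [D] a section [s] of any term lifts to a section of a term of large
index, and the value of the extension of [lam] at [s] is read from the image of
the lift in [E 0].  It does not depend on the lift, because the transition maps
are injective away from [D]. *)
Let lift_ex a U (s : E a U) : exists y : ratfun k,
  forall W (h : W `<=` U) (hW : W `<=` avoid D) (b : int) (le : a <= b)
    (le0 : 0 <= b) (u : E b W),
  trans E le W u = res h s -> y = lam_val (trans E le0 W u).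
Proof.
pose W1 := zcap U (avoid D); pose b1 := Num.max a 0.
have le1 : a <= b1 by rewrite le_max lexx.
have le01 : 0 <= b1 by rewrite le_max lexx orbT.
have [u1 u1E] := trans_surj_away (@zcapr _ U (avoid D)) le1 (res (@zcapl _ _ _) s).
exists (lam_val (trans E le01 _ u1)) => W h hW b le le0 u uE.
have hW1 : W `<=` W1 by move=> x Wx; split; [exact: (h x Wx) | exact: (hW x Wx)].
pose c := Num.max b b1.
have lec : b <= c by rewrite le_max lexx.
have lec1 : b1 <= c by rewrite le_max lexx orbT.
have [v vE] := trans_surj_away hW lec u.
have [v1 v1E] := trans_surj_away (@zcapr _ U (avoid D)) lec1 u1.
have lea : a <= c := le_trans le lec.
have le0c : 0 <= c := le_trans le0 lec.
have vv : res hW1 v1 = v.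
  apply: (trans_inj_away hW (le := lea)).
  rewrite smap_res -(trans_comp le1 lec1 lea) v1E u1E (res_res _ _ h) -uE.
  by rewrite -vE (trans_comp le lec lea).
rewrite -v1E -vE (trans_comp _ _ le0c) (trans_comp _ _ le0c) -vv smap_res.
by rewrite lam_res.
Qed.

Definition extension a U (s : E a U) : ratfun k := projT1 (cid (lift_ex s)).

Lemma extensionE a U (s : E a U) W (h : W `<=` U) (hW : W `<=` avoid D)
    (b : int) (le : a <= b) (le0 : 0 <= b) (u : E b W) :
  trans E le W u = res h s -> extension s = osecval (lam W (trans E le0 W u)).
Proof. by move=> uE; rewrite /extension; case: cid => y /= Hy; exact: (Hy _ h). Qed.

Lemma extension_lift a U (s : E a U) W (h : W `<=` U) (hW : W `<=` avoid D)
    (b : int) (le : a <= b) (le0 : 0 <= b) :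
  exists u : E b W, trans E le W u = res h s /\
    extension s = osecval (lam W (trans E le0 W u)).
Proof.
have [u uE] := trans_surj_away hW le (res h s).
by exists u; split=> //; exact: (extensionE hW le0 uE).
Qed.

Lemma extension0 U (s : E 0 U) : extension s = osecval (lam U s).
Proof.
have h := @zcapl _ U (avoid D); have hW := @zcapr _ U (avoid D).
rewrite (@extensionE 0 U s _ h hW 0 (lexx 0) (lexx 0) (res h s)) trans_id //.
by rewrite smap_res.
Qed.

Lemma extension_lin a U (c : regfun U) (s s' : E a U) :
  extension (c *: s + s') = regval c * extension s + extension s'.
Proof.
have h := @zcapl _ U (avoid D); have hW := @zcapr _ U (avoid D).
have le : a <= Num.max a 0 by rewrite le_max lexx.
have le0 : 0 <= Num.max a 0 by rewrite le_max lexx orbT.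
have [u [uE ->]] := extension_lift s h hW le le0.
have [u' [u'E ->]] := extension_lift s' h hW le le0.
rewrite (@extensionE a U _ _ h hW _ le le0 (rres h c *: u + u')).
  by rewrite !smap_lin.
by rewrite smap_lin uE u'E res_lin.
Qed.

Lemma extension_res a U V (h : V `<=` U) (s : E a U) :
  extension (res h s) = extension s.
Proof.
have hV := @zcapl _ V (avoid D); have hW := @zcapr _ V (avoid D).
have le : a <= Num.max a 0 by rewrite le_max lexx.
have le0 : 0 <= Num.max a 0 by rewrite le_max lexx orbT.
have [u [uE ->]] := extension_lift (res h s) hV hW le le0.
have hU : zcap V (avoid D) `<=` U by move=> x [/h].
by rewrite (@extensionE a U s _ hU hW _ le le0 u) // uE (res_res _ _ hU).
Qed.

Lemma extension_trans (a a' : int) (le : a <= a') U (s : E a' U) :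
  extension (trans E le U s) = extension s.
Proof.
have h := @zcapl _ U (avoid D); have hW := @zcapr _ U (avoid D).
have le' : a' <= Num.max a' 0 by rewrite le_max lexx.
have le0 : 0 <= Num.max a' 0 by rewrite le_max lexx orbT.
have [u [uE ->]] := extension_lift s h hW le' le0.
apply: (@extensionE _ _ _ _ h hW _ (le_trans le le') le0 u).
by rewrite -(trans_comp le le') uE smap_res.
Qed.

Lemma extension_jmap (a a' : int) (e : a' = a + r%:Z) U (s : E a U) (f : Oideal D U) :
  extension (jmap E e U s f) = extension s * osecval f.
Proof.
have h := @zcapl _ U (avoid D); have hW := @zcapr _ U (avoid D).
pose b := Num.max a 0.
have le : a <= b by rewrite le_max lexx.
have le0 : 0 <= b by rewrite le_max lexx orbT.
have [u [uE ->]] := extension_lift s h hW le le0.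
have leb : b <= b + r%:Z by lia.
have le' : a' <= b + r%:Z by rewrite e lerD2r.
have le0' : 0 <= b + r%:Z by exact: le_trans leb.
rewrite (@extensionE _ _ _ _ h hW _ le' le0' (jmap E erefl _ u (res h f))).
  rewrite -(trans_comp le0 leb) jmap_trans.
  by rewrite !smapZ mulrC.
by rewrite (jmap_natural e erefl le) uE bimap_res.
Qed.

(** Near [x] the periodicity isomorphisms are multiplication by a generator of the
ideal of [D], which changes the index by [r] and the order by [divisor D x]. *)
Lemma extension_ord_period (q a : int) U (s : E a U) x : a = q * r%:Z -> zset U x ->
  ord_ge x (q * divisor D x - delta x) (extension s).
Proof.
have [Ux [f [Uxx gf]]] := local_ideal_generator x.
have near a' V (t : E a' V) n : zset V x ->
    (forall W (t' : E a' W), zset W x -> W `<=` Ux -> ord_ge x n (extension t')) ->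
    ord_ge x n (extension t).
  move=> Vx H; rewrite -(extension_res (@zcapl _ V Ux)); apply: H; last exact: zcapr.
  by split.
have gen W (h : W `<=` Ux) : ideal_generator (res h f : Oideal D W).
  move=> V hV g; have hVU : V `<=` Ux by move=> y /hV/h.
  by have [c ->] := gf V hVU g; exists c; rewrite (res_res _ _ hVU).
elim/int_ind: q a U s => [|q IH|q IH] a U s aE Uxs.
- rewrite mul0r add0r; have {}aE : a = 0 by rewrite aE mul0r.
  by subst a; rewrite extension0; exact: osec_ord.
- apply: near => // W t Wx h.
  have e : a = q%:Z * r%:Z + r%:Z by rewrite aE; nia.
  have [g _ gK] := jmap_iso E e (gen W h).
  rewrite -(gK t) extension_jmap.
  have -> : q.+1%:Z * divisor D x - delta x =
      (q%:Z * divisor D x - delta x) + divisor D x by lia.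
  apply: ord_geM; first exact: IH.
  by rewrite -[divisor D x]opprK; exact: osec_ord.
- apply: near => // W t Wx h.
  have e : - q%:Z * r%:Z = a + r%:Z by rewrite aE; nia.
  have [g0 gV] := ideal_generatorP (gen W h).
  have -> : extension t =
      extension (jmap E e W t (res h f)) / osecval (res h f : Oideal D W).
    by rewrite extension_jmap mulfK.
  have -> : - q.+1%:Z * divisor D x - delta x =
      (- q%:Z * divisor D x - delta x) + - divisor D x by lia.
  by apply: ord_geM; [exact: IH | exact: gV].
Qed.

(** The order of the values on [E a] is read from the largest multiple [q r] of the
period with [q r <= a]. *)
Lemma extension_functional :
  functional (fun x => delta x + divisor D x) 1 extension.
Proof.
split; [exact: extension_lin | exact: extension_res | exact: extension_trans
  | exact: extension_jmap |].
move=> a U s x Ux; pose q := ceil_index 1 r (a + 1) - 1.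
have le : q * r%:Z <= a.
  have : q * r%:Z < a + 1 by rewrite -ceil1_gtP /q; lia.
  lia.
rewrite -(extension_trans le).
have -> : - pline_div (fun x => delta x + divisor D x) 1 a x =
    q * divisor D x - delta x by rewrite /pline_div /q; lia.
exact: extension_ord_period.
Qed.
End Extension.

(** The terms with indices from 0 to [r - 1] all map into [E 0], so that their values
satisfy the order condition of [E 0]; the unit is constant on the indices from 1
to [r] instead, whence the shift by 1. *)
Lemma functional_extends (E : psheaf D r) delta (lam : smor (E 0) (OX delta)) :
  exists2 phi, @functional E (fun x => delta x + divisor D x) 1 phi &
    forall U (s : E 0 U), phi 0 U s = osecval (lam U s).
Proof.
exists (fun a U s => extension lam s); first exact: extension_functional.
by move=> U s; exact: extension0.
Qed.

End Level.
End Functionals.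

(** * Rational functions with bounded poles *)

Section Bounded.
Variable k : closedFieldType.
Variables (N : P1 k -> nat) (r : seq (P1 k)).
Hypothesis N_support : forall x, x \notin r -> N x = 0%N.

Definition pole_bounded (c : ratfun k) : Prop := forall x, ord_ge x (- (N x)%:Z) c.

Let g : {poly k} := \prod_(a <- pmap id r) ('X - a%:P) ^+ N (Some a).

Let g_neq0 : g != 0.
Proof.
rewrite /g prodf_seq_neq0; apply/allP => a _ /=.
by rewrite expf_neq0 // polyXsubC_eq0.
Qed.

Let g_clears c a : pole_bounded c -> regular_at (Some a) (g%:F * c).
Proof.
move=> Hc; have [ar|ar] := boolP (Some a \in r); last first.
  apply: regular_atM; first exact: regular_poly.
  by have := Hc (Some a); rewrite N_support // oppr0 regularE.
have ar' : a \in pmap id r by rewrite mem_pmap; apply/mapP; exists (Some a).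
rewrite /g (big_rem a) // tofracM -mulrA mulrCA; apply: regular_atM.
  exact: regular_poly.
rewrite -regularE -(subrr (N (Some a))%:Z); apply: ord_geM => //.
rewrite tofracXn; exact: (@ord_ge_uniformizer _ (Some a)).
Qed.

Let g_infty c n : ord_ge None n c -> ord_ge None (- (size g)%:Z + n) (g%:F * c).
Proof. by apply: ord_geM; exact: ord_ge_infty_poly. Qed.

(** After a common denominator is cleared, functions with bounded poles are
polynomials of bounded degree. *)
Lemma pole_bounded_poly : exists (h : {poly k}) (M : nat), h != 0 /\
  forall c, pole_bounded c -> exists2 p, h%:F * c = p%:F & (size p <= M)%N.
Proof.
exists g, (size g + N None).+1; split=> // c Hc.
have [p pE] := entire_poly (fun a => g_clears a Hc).
exists p => //; apply: size_poly_ord_infty; rewrite -pE PoszD opprD.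
by apply: g_infty; exact: Hc.
Qed.

Let vanish_infty c n : (forall a, regular_at (Some a) (g%:F * c)) ->
  ord_ge None n c -> (size g)%:Z < n -> c = 0.
Proof.
move=> reg /g_infty cn gn; have [p pE] := entire_poly reg.
have p0 : p = 0.
  by apply: ord_infty_poly_eq0; rewrite -pE; apply: ord_ge_le cn; lia.
move/eqP: pE; rewrite p0 tofrac0 mulf_eq0 tofrac_eq0 (negPf g_neq0) /=.
by move/eqP.
Qed.

(** A zero of large order at a finite point [a] is moved to infinity by dividing
by a power of the local parameter [X - a]. *)
Lemma pole_bounded_vanish x : exists t : nat, forall c, pole_bounded c ->
  ord_ge x t%:Z c -> c = 0.
Proof.
case: x => [a|]; last first.
  exists (size g).+1 => c Hc ct; apply: (@vanish_infty c (size g).+1%:Z) => //; last by lia.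
  by move=> a; exact: g_clears.
pose t := (size g + N None).+1; exists t => c Hc ct.
have Xa0 : ('X - a%:P)%:F != 0 :> ratfun k by rewrite tofrac_eq0 polyXsubC_eq0.
suff : c / ('X - a%:P)%:F ^+ t = 0.
  by move/eqP; rewrite mulf_eq0 invr_eq0 expf_eq0 (negPf Xa0) andbF orbF => /eqP.
apply: (@vanish_infty _ (- (N None)%:Z + 1 * t%:Z)); last by rewrite /t; lia.
  move=> b; have [<-|ab] := eqVneq a b.
    by apply: regular_atM; [exact: regular_poly | exact: ct].
  rewrite mulrA; apply: regular_atM; first exact: g_clears.
  exists 1, (('X - a%:P) ^+ t); rewrite tofrac1 div1r tofracXn; split=> //.
  by rewrite horner_exp expf_neq0 // hornerXsubC subr_eq0 eq_sym.
apply: ord_geM; first exact: Hc.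
rewrite -exprVn; apply: ord_ge_expr.
exists 'X, ('X - a%:P); split; rewrite ?polyXsubC_eq0 //.
  by rewrite size_polyX size_XsubC.
by rewrite expr1z /= invrK mulrC.
Qed.

Definition ratfun_poly (f : ratfun k) : {poly k} :=
  if pselect (exists p : {poly k}, f = p%:F) is left e then projT1 (cid e) else 0.

Lemma ratfun_polyE p : ratfun_poly p%:F = p.
Proof.
rewrite /ratfun_poly; case: pselect => [e|[]]; last by exists p.
by case: cid => q /= /eqP; rewrite tofrac_eq => /eqP.
Qed.

(** A space with an injective linear map [kap] to vectors of functions with bounded
poles embeds into a space of matrices of coefficients of polynomials. *)
Lemma hasdim_pole_bounded (A : Type) (o : A) (lin : k -> A -> A -> A)
    (S : A -> Prop) (n : nat) (kap : A -> 'rV[ratfun k]_n) :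
  S o -> (forall c u v, S u -> S v -> S (lin c u v)) ->
  (forall c u v, S u -> S v -> kap (lin c u v) = c%:P%:F *: kap u + kap v) ->
  kap o = 0 -> (forall u v, S u -> S v -> kap u = kap v -> u = v) ->
  (forall u j, S u -> pole_bounded (kap u 0 j)) ->
  exists d, hasdim o lin S d.
Proof.
move=> So Slin klin ko kinj kb; have [h [M [h0 hM]]] := pole_bounded_poly.
pose q u j := ratfun_poly (h%:F * kap u 0 j).
have qE u j : S u -> h%:F * kap u 0 j = (q u j)%:F.
  by move=> Su; have [p pE _] := hM _ (kb u j Su); rewrite /q pE ratfun_polyE.
have qM u j : S u -> (size (q u j) <= M)%N.
  move=> Su; have [p pE pM] := hM _ (kb u j Su).
  by move: (qE u j Su); rewrite pE => /eqP; rewrite tofrac_eq => /eqP <-.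
pose K u : 'rV[k]_(n * M) := mxvec (\matrix_(j < n, i < M) (q u j)`_i).
apply: (@hasdim_embed k A o lin S _ K) => //.
- move=> c u v Su Sv; rewrite /K -linearP; congr mxvec; apply/matrixP => j i.
  rewrite !mxE; have -> : q (lin c u v) j = c%:P * q u j + q v j.
    apply/eqP; rewrite -tofrac_eq tofracD tofracM -!qE //; last exact: Slin.
    by rewrite klin // !mxE mulrDr mulrCA.
  by rewrite coefD coefCM.
- rewrite /K; have -> : \matrix_(j < n, i < M) (q o j)`_i = 0; last by rewrite linear0.
  apply/matrixP => j i; rewrite !mxE; have -> : q o j = 0; last by rewrite coef0.
  by apply/eqP; rewrite -tofrac_eq -qE // ko mxE mulr0 tofrac0.
- move=> u v Su Sv /(can_inj mxvecK)/matrixP uv; apply: kinj => //.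
  apply/rowP => j; apply: (mulfI (x := h%:F)); first by rewrite tofrac_eq0.
  rewrite !qE //; congr (_ %:F); apply/polyP => i.
  have [iM|Mi] := ltnP i M; first by have := uv j (Ordinal iM); rewrite !mxE.
  by rewrite !nth_default // (leq_trans (qM _ _ _)).
Qed.

End Bounded.

(** * Growth of dimensions along tensor powers *)

Section Growth.
Variables (k : closedFieldType) (D : seq (P1 k)) (r : nat).
Variable dimG : nat -> psheaf D r -> nat -> Prop.
Hypothesis dimG_uniq : forall t E d d', dimG t E d -> dimG t E d' -> d = d'.
Hypothesis dimG_zero : forall t, dimG t (pzero D r) 0.
Hypothesis dimG_plus : forall t E E' d d',
  dimG t E d -> dimG t E' d' -> dimG t (pplus E E') (d + d').
Hypothesis dimG_iso : forall t E E' d, piso E E' -> dimG t E d -> dimG t E' d.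

Variable T : nat -> psheaf D r.
Hypothesis dimT : forall t i, exists d, dimG t (T i) d.
Hypothesis dimT_start : forall d, dimG 0 (T 0) d -> d != 0%N.
Hypothesis dimT_grow : forall t i d d', dimG t (T i) d -> d != 0%N ->
  dimG t.+1 (T i.+1) d' -> d' != 0%N.
Hypothesis dimT_bounded : forall i, exists t0, forall t d, (t0 <= t)%N ->
  dimG t (T i) d -> d = 0%N.

Lemma dimG_peval h t (P : {poly nat}) : (forall i, dimG t (T i) (h i)) ->
  dimG t (peval T P) (\sum_(i < size P) (P`_i)%R * h i)%N.
Proof.
move=> hT; rewrite /peval; elim/big_rec2: _ => [|i d E _ Ed]; first exact: dimG_zero.
apply: dimG_plus Ed; elim: P`_i => [|n IH] /=; first exact: dimG_zero.
by rewrite mulSn; exact: dimG_plus.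
Qed.

(** Let [N] be the largest degree where the coefficients of [P] and [Q] differ and
[t] the largest index where [dimG t (T N)] is nonzero.  The terms of degree above
[N] contribute the same to both sides, and those of degree below [N] contribute
nothing, because their dimensions would propagate to [T N] at an index above [t]. *)
Lemma growth_injective (P Q : {poly nat}) : piso (peval T P) (peval T Q) -> P = Q.
Proof.
move=> PQ; have /choice[h0 h0E] ti : exists d, dimG ti.1 (T ti.2) d by exact: dimT.
pose h t i := h0 (t, i); have hE t i : dimG t (T i) (h t i) by exact: (h0E (t, i)).
pose n := maxn (size P) (size Q).
have sumE t (R : {poly nat}) : (size R <= n)%N ->
    (\sum_(i < size R) (R`_i)%R * h t i = \sum_(i < n) (R`_i)%R * h t i)%N.
  move=> Rn; rewrite (big_ord_widen n (fun i => (R`_i)%R * h t i)%N Rn).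
  rewrite big_mkcond /=; apply: eq_bigr => i _; case: ltnP => // Ri.
  by rewrite nth_default.
have PQh t : (\sum_(i < n) (P`_i)%R * h t i = \sum_(i < n) (Q`_i)%R * h t i)%N.
  rewrite -!sumE ?leq_maxl ?leq_maxr //.
  exact: dimG_uniq (dimG_iso PQ (dimG_peval P (hE t))) (dimG_peval Q (hE t)).
have grow s t i : h t i != 0%N -> h (t + s)%N (i + s)%N != 0%N.
  move=> hti; elim: s => [|s IH]; first by rewrite !addn0.
  by rewrite !addnS; exact: dimT_grow IH (hE _ _).
have diag i : h i i != 0%N by apply: (grow i 0%N 0%N); exact: dimT_start (hE 0%N 0%N).
apply: contrapT => neqPQ.
have exN : exists i, P`_i != Q`_i.
  apply: contrapT => H; apply: neqPQ; apply/polyP => i; apply/eqP/negPn/negP => Hi.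
  by apply: H; exists i.
have bdN i : P`_i != Q`_i -> (i <= n)%N.
  apply: contraNT; rewrite -ltnNge /n gtn_max => /andP[Pi Qi].
  by rewrite !nth_default // ltnW.
have [N PQN maxN] := ex_maxnP exN bdN.
have Nn : (N < n)%N.
  rewrite ltn_neqAle bdN // andbT; apply: contraNneq PQN => ->.
  by rewrite !nth_default ?leq_maxl ?leq_maxr.
have [t0 t0E] := dimT_bounded N.
have bdt t : h t N != 0%N -> (t <= t0)%N.
  move=> ht; rewrite leqNgt; apply: contra ht => t0t.
  by rewrite (t0E _ _ (ltnW t0t) (hE t N)).
have [t htN maxt] := ex_maxnP (ex_intro (fun t => h t N != 0%N) N (diag N)) bdt.
have low i : (i < N)%N -> h t i = 0%N.
  move=> iN; apply/eqP; apply: contraTT isT => hti.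
  have := maxt (t + (N - i))%N; rewrite -{2}(subnKC (ltnW iN)).
  by move/(_ (grow _ _ _ hti)); rewrite -{2}[t]addn0 leq_add2l leqn0 subn_eq0 leqNgt iN.
have := PQh t; rewrite (bigD1 (Ordinal Nn)) //= [RHS](bigD1 (Ordinal Nn)) //=.
have -> : (\sum_(i < n | i != Ordinal Nn) (P`_i)%R * h t i =
    \sum_(i < n | i != Ordinal Nn) (Q`_i)%R * h t i)%N.
  apply: eq_bigr => i; rewrite -val_eqE /= => iN.
  have [iltN|Nlti|] := ltngtP i N; last by move/eqP; rewrite (negPf iN).
    by rewrite low // !muln0.
  congr (_ * _)%N; apply/eqP/negPn/negP => /maxN.
  by rewrite leqNgt Nlti.
move/addIn/eqP; rewrite eqn_mul2r (negPf htN) /=.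
by apply/negP.
Qed.

End Growth.

(** * Functionals to the shifts of the unit *)

Section LatticeTheory.
Variables (k : closedFieldType) (F : sheaf k) (n : nat).
Variables (gc : forall U, F U -> 'rV[ratfun k]_n) (N : P1 k -> nat).
Hypothesis gcP : lattice gc N.

Implicit Types U W : zopen k.

Lemma lattice0 U : gc (0 : F U) = 0.
Proof.
have := lattice_lin gcP (-1) (0 : F U) 0.
by rewrite scaler0 addr0 (_ : regval (-1) = -1) // scaleN1r addNr.
Qed.

Lemma lattice_sum (I : finType) U (c : I -> regfun U) (s : I -> F U) :
  gc (\sum_i c i *: s i) = \sum_i regval (c i) *: gc (s i).
Proof.
elim/big_rec2: _ => [|i v t _ <-]; [exact: lattice0 | exact: (lattice_lin gcP)].
Qed.

(** Sections whose coordinates form the standard basis; they exist on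
neighbourhoods of any point where the lattice is the standard one. *)
Lemma lattice_generic_basis : exists (U : 'I_n -> zopen k) (s : forall j, F (U j)),
  forall j, gc (s j) = delta_mx 0 j.
Proof.
have [l lN] := lattice_support gcP.
have [x xl] := zopen_nonempty (avoid l).
have /choice[Us UsE] (j : 'I_n) : exists Us : {U : zopen k & F U},
    gc (projT2 Us) = delta_mx 0 j.
  have [U [s [_ sE]]] := lattice_basis gcP x j; exists (existT _ U s).
  by rewrite sE lN // expr0 scale1r.
by exists (fun j => projT1 (Us j)), (fun j => projT2 (Us j)).
Qed.

Lemma lattice_expand U (s : F U) (V : 'I_n -> zopen k) (e : forall j, F (V j)) :
  (forall j, gc (e j) = delta_mx 0 j) ->
  exists (W : zopen k) (h : W `<=` U) (hV : forall j, W `<=` V j)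
    (c : 'I_n -> regfun W),
    (forall j, regval (c j) = gc s 0 j) /\ res h s = \sum_j c j *: res (hV j) (e j).
Proof.
move=> eE; pose f j := gc s 0 j.
pose W := zcap U (zcap (zbigcap V) (zbigcap (fun j => regular_locus (f j)))).
have hV j : W `<=` V j by move=> x [_ [Vx _]]; exact: Vx.
have fW j : f j \in regular W by apply/asboolP => x [_ [_ fx]]; exact: fx.
exists W, (@zcapl _ _ _), hV, (fun j => RegFun (fW j)); split=> //.
apply: (lattice_inj gcP); rewrite (lattice_res gcP) lattice_sum.
rewrite [LHS]row_sum_delta; apply: eq_bigr => j _.
by rewrite (lattice_res gcP) eE.
Qed.

End LatticeTheory.

Section FunctionalSpace.
Variables (k : closedFieldType) (D : seq (P1 k)) (r : nat) (r_gt0 : (0 < r)%N).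
Implicit Types (E : psheaf D r) (delta : P1 k -> int).

Definition rat_family E := forall (a : int) (U : zopen k), E a U -> ratfun k.

Definition family_zero E : rat_family E := fun a U s => 0.

Definition family_lin E (c : k) (phi psi : rat_family E) : rat_family E :=
  fun a U s => c%:P%:F * phi a U s + psi a U s.

Lemma familyP E (phi psi : rat_family E) :
  (forall a U s, phi a U s = psi a U s) -> phi = psi.
Proof.
move=> H; apply: functional_extensionality_dep => a.
by apply: functional_extensionality_dep => U; apply/funext => s.
Qed.

Lemma family_neq0 E (phi : rat_family E) : phi <> @family_zero E ->
  exists a U s, phi a U s != 0.
Proof.
move=> phi0; apply: contrapT => H; apply: phi0; apply: familyP => a U s.
by apply/eqP/negPn/negP => Hs; apply: H; exists a, U, s.
Qed.

Lemma functional_zero E delta t : functional delta t (@family_zero E).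
Proof.
split=> [a U c s s'|||a a' e U s f|a U s x _] //; rewrite /family_zero.
- by rewrite mulr0 addr0.
- by rewrite mul0r.
- exact: ord_ge0.
Qed.

Lemma functional_family_lin E delta t (c : k) (phi psi : rat_family E) :
  functional delta t phi -> functional delta t psi ->
  functional delta t (family_lin c phi psi).
Proof.
move=> [l1 r1 t1 j1 o1] [l2 r2 t2 j2 o2]; split; rewrite /family_lin.
- by move=> a U c' s s'; rewrite l1 l2; ring.
- by move=> a U V h s; rewrite r1 r2.
- by move=> a a' le U s; rewrite t1 t2.
- by move=> a a' e U s f; rewrite j1 j2; ring.
- move=> a U s x Ux; apply: ord_geD; last exact: o2.
  rewrite -[- _]add0r; apply: ord_geM; last exact: o1.
  exact: (regfun_ord (constant (zfull k) c)).
Qed.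

(** Every section lifts, away from [D], to a term of nonnegative index, which maps to
[E 0]. *)
Lemma functional_det E delta t (phi psi : rat_family E) :
  functional delta t phi -> functional delta t psi ->
  (forall U (s : E 0 U), phi 0 U s = psi 0 U s) -> phi = psi.
Proof.
move=> P1 P2 H; apply: familyP => a U s.
pose W := zcap U (avoid D); have h : W `<=` U := @zcapl _ _ _.
have le : a <= Num.max a 0 by rewrite le_max lexx.
have le0 : 0 <= Num.max a 0 by rewrite le_max lexx orbT.
have [u uE] := trans_surj_away r_gt0 (@zcapr _ U (avoid D)) le (res h s).
rewrite -(functional_res P1 h) -(functional_res P2 h) -uE.
rewrite (functional_trans P1) (functional_trans P2).
by rewrite -(functional_trans P1 le0) -(functional_trans P2 le0) H.
Qed.

Section Coordinates.
Variables (E : psheaf D r) (n : nat) (gc : forall U, E 0 U -> 'rV[ratfun k]_n).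
Variables (N : P1 k -> nat) (gcP : lattice gc N).
Variables (V : 'I_n -> zopen k) (e : forall j, E 0 (V j)).
Hypothesis eE : forall j, gc (e j) = delta_mx 0 j.

Lemma functional_expand delta t (phi : rat_family E) U (s : E 0 U) :
  functional delta t phi -> phi 0 U s = \sum_j gc s 0 j * phi 0 _ (e j).
Proof.
move=> P; have [W [h [hV [c [cE sE]]]]] := lattice_expand gcP s eE.
rewrite -(functional_res P h) sE.
transitivity (\sum_j regval (c j) * phi 0 W (res (hV j) (e j))).
  elim/big_rec2: _ => [|j y z _ <-]; first exact: (functional0 P).
  exact: (functional_lin P).
by apply: eq_bigr => j _; rewrite cE (functional_res P).
Qed.

(** The stalk at [x] contains [pi^N] times the basis, so that a functional has a pole
of order at most [N] more at the basis than at sections regular at [x]. *)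
Lemma functional_basis_ord delta (t : int) (phi : rat_family E) x j :
  functional delta t phi ->
  ord_ge x (- pline_div D r delta t 0 x - (N x)%:Z) (phi 0 _ (e j)).
Proof.
move=> P; have [U [s [Ux sE]]] := lattice_basis gcP x j.
have := functional_ord P s Ux; rewrite (functional_expand s P).
have -> : \sum_i gc s 0 i * phi 0 _ (e i) = uniformizer x ^+ N x * phi 0 _ (e j).
  rewrite (bigD1 j) //= sE !mxE !eqxx mulr1 big1 ?addr0 // => i /negPf ij.
  by rewrite !mxE eqxx ij mulr0 mul0r.
move=> H; have := ord_geM (ord_ge_uniformizer x (- (N x)%:Z)) H.
rewrite -exprnN mulrA mulVf ?expf_neq0 ?uniformizer_neq0 // mul1r.
by rewrite addrC.
Qed.

End Coordinates.

(** Morphisms to the unit shifted by [t]. *)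
Definition dim_functional (t : nat) E (d : nat) : Prop :=
  hasdim (@family_zero E) (@family_lin E)
    (fun phi => functional (fun=> 0) t%:Z phi) d.

Lemma pline_div_le0 (t : nat) x : pline_div D r (fun=> 0) t%:Z 0 x <= 0.
Proof.
rewrite /pline_div !add0r oppr_le0 mulr_ge0 ?divisor_ge0 //.
by have := ceil1_gtP r_gt0 t%:Z (-1); nia.
Qed.

Lemma functional_pole_bounded E n gc N V (e : forall j, E 0 (V j)) (t : nat)
    (phi : rat_family E) j x : @lattice k (E 0) n gc N ->
  (forall j, gc _ (e j) = delta_mx 0 j) -> functional (fun=> 0) t%:Z phi ->
  ord_ge x (- (N x)%:Z) (phi 0 _ (e j)).
Proof.
move=> gcP eE P; apply: ord_ge_le (functional_basis_ord gcP eE x j P).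
have := pline_div_le0 t x; lia.
Qed.

Lemma dim_functional_exists t E : locally_free (E 0) -> exists d, dim_functional t E d.
Proof.
move=> /locally_free_lattice[n [gc [N gcP]]].
have [V [e eE]] := lattice_generic_basis gcP.
have [l lN] := lattice_support gcP.
apply: (@hasdim_pole_bounded _ N l lN _ _ _ _ n (fun phi => \row_j phi 0 _ (e j))).
- exact: functional_zero.
- by move=> c u v; exact: functional_family_lin.
- by move=> c u v _ _; apply/rowP => j; rewrite !mxE.
- by apply/rowP => j; rewrite !mxE.
- move=> u v Pu Pv /rowP uv; apply: (functional_det Pu Pv) => U s.
  rewrite (functional_expand gcP eE s Pu) (functional_expand gcP eE s Pv).
  by apply: eq_bigr => j _; have := uv j; rewrite !mxE => ->.
- by move=> u j P x; rewrite mxE; exact: functional_pole_bounded gcP eE P.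
Qed.

(** The order at a point of [D] grows with [t], while the poles stay bounded. *)
Lemma dim_functional_bounded E : (0 < size D)%N -> locally_free (E 0) ->
  exists t0, forall t d, (t0 <= t)%N -> dim_functional t E d -> d = 0%N.
Proof.
move=> D0 /locally_free_lattice[n [gc [N gcP]]].
have [V [e eE]] := lattice_generic_basis gcP.
have [l lN] := lattice_support gcP.
have [y yD] : exists y, y \in D by case: (D) D0 => // y s _; exists y; rewrite mem_head.
have [b vb] := pole_bounded_vanish lN y.
exists ((b + N y) * r)%N => t d tb dimd; apply/eqP/negPn/negP.
move/(hasdim_neq0 dimd) => [phi P]; apply.
apply: (functional_det P (functional_zero _ _ _)) => U s.
rewrite (functional_expand gcP eE s P) big1 // => j _.
rewrite [X in _ * X]vb ?mulr0 //.
  by move=> x; exact: functional_pole_bounded gcP eE P.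
apply: ord_ge_le (functional_basis_ord gcP eE y j P).
rewrite /pline_div !add0r opprK.
have c_ge : (b + N y)%:Z <= ceil_index 1 r t%:Z.
  rewrite leNgt; apply/negP => c_lt.
  have : ceil_index 1 r t%:Z <= (b + N y)%:Z - 1 by lia.
  by rewrite ceil1_leP //; nia.
have D_ge : 1 <= divisor D y by rewrite /divisor lez_nat -has_count has_pred1.
nia.
Qed.

Lemma dim_functional_zero t : dim_functional t (pzero D r) 0.
Proof.
apply: hasdim0 => [c|phi].
  by apply: familyP => a U s; rewrite /family_lin mulr0 addr0.
split=> [P|->]; last exact: functional_zero.
apply: familyP => a U s; rewrite (_ : s = 0); last exact: thinmx0.
exact: (functional0 P).
Qed.

Lemma dim_functional_plus t E E' d d' : dim_functional t E d -> dim_functional t E' d' ->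
  dim_functional t (pplus E E') (d + d').
Proof.
apply: (hasdim_sum (tau := fun (phi : rat_family E) (psi : rat_family E') =>
  (fun a U (s : pplus E E' a U) => phi a U s.1 + psi a U s.2) : rat_family (pplus E E'))).
- by apply: familyP => a U s; rewrite addr0.
- by move=> c u1 v1 u2 v2; apply: familyP => a U s; rewrite /family_lin; ring.
- move=> u1 u2 v1 v2 P1 P2 Q1 Q2 uv; split; apply: familyP => a U s.
    have := congr1 (fun phi : rat_family (pplus E E') => phi a U (s, 0)) uv.
    by rewrite /= (functional0 P2) (functional0 Q2) !addr0.
  have := congr1 (fun phi : rat_family (pplus E E') => phi a U (0, s)) uv.
  by rewrite /= (functional0 P1) (functional0 Q1) !add0r.
move=> phi; split=> [P|[phi1 [phi2 [[l1 r1 t1 j1 o1] [l2 r2 t2 j2 o2] ->]]]]; last first.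
  split.
  - by move=> a U c [s1 s2] [s1' s2'] /=; rewrite l1 l2; ring.
  - by move=> a U V h [s1 s2] /=; rewrite r1 r2.
  - by move=> a a' le U [s1 s2] /=; rewrite t1 t2.
  - by move=> a a' e U [s1 s2] f /=; rewrite j1 j2; ring.
  - by move=> a U [s1 s2] x Ux /=; apply: ord_geD; [exact: o1 | exact: o2].
exists (fun a U s => phi a U (s, 0)), (fun a U s => phi a U (0, s)); split.
- split.
  - move=> a U c s s'; rewrite -(functional_lin P); congr (phi a U _).
    by congr pair; rewrite /= scaler0 addr0.
  - move=> a U V h s; rewrite -(functional_res P h); congr (phi a V _).
    by congr pair; rewrite res0.
  - move=> a a' le U s; rewrite -(functional_trans P le); congr (phi a U _).
    by congr pair; rewrite smap0.
  - move=> a a' e U s f; rewrite -(functional_jmap P e); congr (phi a' U _).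
    by congr pair; rewrite bimap0l.
  - by move=> a U s x Ux; exact: (functional_ord P).
- split.
  - move=> a U c s s'; rewrite -(functional_lin P); congr (phi a U _).
    by congr pair; rewrite /= scaler0 addr0.
  - move=> a U V h s; rewrite -(functional_res P h); congr (phi a V _).
    by congr pair; rewrite res0.
  - move=> a a' le U s; rewrite -(functional_trans P le); congr (phi a U _).
    by congr pair; rewrite smap0.
  - move=> a a' e U s f; rewrite -(functional_jmap P e); congr (phi a' U _).
    by congr pair; rewrite bimap0l.
  - by move=> a U s x Ux; exact: (functional_ord P).
- apply: familyP => a U [s1 s2].
  have := functional_lin P 1 ((s1, 0) : pplus E E' a U) (0, s2).
  rewrite scale1r mul1r => <-; congr (phi a U _).
  by congr pair; rewrite ?addr0 ?add0r.
Qed.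

Lemma functional_comp E E' delta t (f : pmor E' E) (phi : rat_family E) :
  functional delta t phi ->
  functional delta t ((fun a U s => phi a U (f a U s)) : rat_family E').
Proof.
move=> [l1 r1 t1 j1 o1]; split.
- by move=> a U c s s'; rewrite smap_lin l1.
- by move=> a U V h s; rewrite smap_res r1.
- by move=> a a' le U s; rewrite pmap_trans t1.
- by move=> a a' e U s g; rewrite pmap_jmap j1.
- by move=> a U s x; exact: o1.
Qed.

Lemma dim_functional_iso t E E' d : piso E E' -> dim_functional t E d ->
  dim_functional t E' d.
Proof.
move=> [f [g fg]].
apply: (hasdim_iso
  (tau := fun phi : rat_family E => (fun a U s => phi a U (g a U s)) : rat_family E')
  (sig := fun phi : rat_family E' => (fun a U s => phi a U (f a U s)) : rat_family E)).
- by [].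
- by [].
- by move=> phi; apply: familyP => a U s; have [-> _] := fg a U.
- by move=> phi; apply: familyP => a U s; have [_ ->] := fg a U.
- by move=> phi; exact: functional_comp.
- by move=> phi; exact: functional_comp.
Qed.

Lemma functional_unit :
  functional (fun=> 0) 0 ((fun a U s => osecval s) : rat_family (punit D r_gt0)).
Proof.
split=> //.
- by move=> a U s x Ux; rewrite /pline_div addr0 sub0r; exact: osec_ord.
Qed.

End FunctionalSpace.

(** * Sections vanishing at infinity *)

Section SectionSpace.
Variables (k : closedFieldType) (D : seq (P1 k)) (r : nat) (r_gt0 : (0 < r)%N).
Implicit Types (E : psheaf D r) (F G H : sheaf k) (U V W : zopen k).

Let U1 : zopen k := avoid [:: Some 0].

Lemma inverse_coordinate_regular : ('X%:F)^-1 \in regular U1.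
Proof.
apply/asboolP => -[a|] /=; last by move=> _; exact: (regular_at_uniformizer (None : P1 k)).
rewrite inE => /eqP a0; exists 1, 'X; rewrite hornerX tofrac1 div1r; split=> //.
by apply/eqP => a0'; apply: a0; rewrite a0'.
Qed.

Let zi : regfun U1 := RegFun inverse_coordinate_regular.

(** Global sections with a zero of order at least [t] at infinity. *)
Definition vanishing (F : sheaf k) (t : nat) (s : F (zfull k)) : Prop :=
  exists s1 : F U1, res (@zsub_full k U1) s = zi ^+ t *: s1.

Definition section_lin (F : sheaf k) (c : k) (s s' : F (zfull k)) : F (zfull k) :=
  constant (zfull k) c *: s + s'.

Lemma vanishing0 F t : @vanishing F t 0.
Proof. by exists 0; rewrite res0 scaler0. Qed.

Lemma vanishing_lin F t c (s s' : F (zfull k)) :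
  vanishing t s -> vanishing t s' -> vanishing t (section_lin c s s').
Proof.
move=> [s1 s1E] [s1' s1'E]; exists (constant U1 c *: s1 + s1').
rewrite /section_lin res_lin s1E s1'E scalerDr !scalerA mulrC.
by congr (_ *: _ + _); congr (_ * _); exact/val_inj.
Qed.

Lemma vanishing_smor F G (f : smor F G) t (s : F (zfull k)) :
  vanishing t s -> vanishing t (f _ s).
Proof. by move=> [s1 s1E]; exists (f _ s1); rewrite -smap_res s1E smapZ. Qed.

Lemma vanishing_bimor F G H (f : bimor F G H) t t' (s : F (zfull k)) (s' : G (zfull k)) :
  vanishing t s -> vanishing t' s' -> vanishing (t + t') (f _ s s').
Proof.
move=> [s1 s1E] [s1' s1'E]; exists (f _ s1 s1').
by rewrite -bimap_res s1E s1'E bimapZ exprD.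
Qed.

Definition dim_section (t : nat) E (d : nat) : Prop :=
  hasdim 0 (@section_lin (E 0)) (@vanishing (E 0) t) d.

Lemma dim_section_exists t E : locally_free (E 0) -> exists d, dim_section t E d.
Proof.
move=> /locally_free_lattice[n [gc [N gcP]]]; have [l lN] := lattice_support gcP.
apply: (@hasdim_pole_bounded _ N l lN _ _ _ _ n (@gc (zfull k))).
- exact: vanishing0.
- by move=> c u v; exact: vanishing_lin.
- by move=> c u v _ _; exact: (lattice_lin gcP).
- exact: lattice0 gcP _.
- by move=> u v _ _; exact: (lattice_inj gcP).
- by move=> u j _ x; exact: (lattice_pole gcP).
Qed.

Lemma dim_section_bounded E : locally_free (E 0) ->
  exists t0, forall t d, (t0 <= t)%N -> dim_section t E d -> d = 0%N.
Proof.
move=> /locally_free_lattice[n [gc [N gcP]]]; have [l lN] := lattice_support gcP.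
have [b vb] := pole_bounded_vanish lN None.
exists (b + N None)%N => t d tb dimd; apply/eqP/negPn/negP.
move/(hasdim_neq0 dimd) => [s [s1 s1E]]; apply; apply: (lattice_inj gcP).
rewrite (lattice0 gcP); apply/rowP => j; rewrite mxE.
apply: vb; first by move=> x; exact: (lattice_pole gcP).
have -> : gc _ s = ('X%:F)^-1 ^+ t *: gc _ s1.
  rewrite -(lattice_res gcP (@zsub_full k U1)) s1E.
  have := lattice_lin gcP (zi ^+ t) s1 0.
  by rewrite (lattice0 gcP) !addr0 regvalX.
rewrite mxE; apply: (@ord_ge_le _ _ _ (t%:Z + - (N None)%:Z)); first by lia.
apply: ord_geM; first exact: (ord_ge_uniformizer (None : P1 k) t%:Z).
exact: (lattice_pole gcP).
Qed.

Lemma dim_section_zero t : dim_section t (pzero D r) 0.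
Proof.
apply: hasdim0 => [c|s]; first by rewrite /section_lin scaler0 addr0.
split=> [_|->]; [exact: thinmx0 | exact: vanishing0].
Qed.

Lemma dim_section_plus t E E' d d' : dim_section t E d -> dim_section t E' d' ->
  dim_section t (pplus E E') (d + d').
Proof.
apply: (hasdim_sum (tau := fun s s' => (s, s') : pplus E E' 0 (zfull k))) => //.
  by move=> u1 u2 v1 v2 _ _ _ _ [-> ->].
move=> [s s']; split=> [[[s1 s1'] [sE s'E]]|[a [a' [[s1 s1E] [s1' s1'E] [-> ->]]]]].
  by exists s, s'; split=> //; [exists s1 | exists s1'].
by exists (s1, s1'); congr pair.
Qed.

Lemma dim_section_iso t E E' d : piso E E' -> dim_section t E d -> dim_section t E' d.
Proof.
move=> [f [g fg]]; have [fK gK] := fg 0 (zfull k).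
apply: (hasdim_iso (tau := f 0 (zfull k)) (sig := g 0 (zfull k))) => //.
- exact: smap0.
- by move=> c u v; rewrite /section_lin smap_lin.
- by move=> s; exact: vanishing_smor.
- by move=> s; exact: vanishing_smor.
Qed.

(** Coordinates on the generic fibre of [E 0] extend to functionals on [E]. *)
Lemma functional_separates E U (s : E 0 U) : locally_free (E 0) -> s <> 0 ->
  exists delta t phi, @functional k D r E delta t phi /\ phi 0 U s != 0.
Proof.
move=> /locally_free_lattice[n [gc [N gcP]]] s0.
have [j sj] : exists j, gc U s 0 j != 0.
  apply: contrapT => H; apply: s0; apply: (lattice_inj gcP).
  rewrite (lattice0 gcP); apply/rowP => j; rewrite mxE.
  by apply/eqP/negPn/negP => Hj; apply: H; exists j.
pose delta x := (N x)%:Z.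
have P V (u : E 0 V) : gc V u 0 j \in osec_pred delta V.
  by apply/asboolP => x; exact: (lattice_pole gcP).
pose l V (u : E 0 V) : OX delta V := OSec (P V u).
have l_lin V : linear (l V).
  by move=> c u v; apply/val_inj; rewrite /= (lattice_lin gcP) !mxE.
have l_res V W (h : W `<=` V) (u : E 0 V) : l W (res h u) = res h (l V u).
  by apply/val_inj; rewrite /= (lattice_res gcP).
have [phi phiP phiE] := functional_extends r_gt0 (SMor l_lin l_res).
by exists (fun x => delta x + divisor D x), 1, phi; split; last by rewrite phiE.
Qed.

(** The product of two functionals that do not vanish at [s] and [s'] factors through
the tensor product and does not vanish at the image of [s] and [s']. *)
Lemma universal_pairing_neq0 E E' T (p : pairing E E' T) U (s : E 0 U) (s' : E' 0 U) :
  universal_pairing p -> locally_free (E 0) -> locally_free (E' 0) ->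
  s <> 0 -> s' <> 0 -> p 0 0 U s s' <> 0.
Proof.
move=> up lf lf' s0 s'0 pss.
have [delta [t [phi [P phis]]]] := functional_separates lf s0.
have [delta' [t' [phi' [P' phi's]]]] := functional_separates lf' s'0.
have [psi psiP psiE] := functional_tensor r_gt0 up P P'.
have := psiE 0 0 U s s'; rewrite pss (functional0 psiP) => /esym/eqP.
by rewrite mulf_eq0 (negPf phis) (negPf phi's).
Qed.

End SectionSpace.

(** * Direct sums of line bundles *)

Section DirectSums.
Variable k : closedFieldType.
Implicit Types U V : zopen k.

Lemma summand_sbigplus n (F : 'I_n -> sheaf k) j :
  exists (i : smor (F j) (sbigplus F)) (q : smor (sbigplus F) (F j)),
    forall U (s : F j U), q U (i U s) = s.
Proof.
rewrite /sbigplus; have := mem_index_enum j.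
elim: (index_enum _) => [|a l IH] //; rewrite big_cons inE.
have [<- _|_ /= jl] := eqVneq j a.
  pose G := \big[@splus k/@szero k]_(i <- l) F i.
  have il U : linear (fun s : F j U => (s, 0) : splus (F j) G U).
    by move=> c s s'; congr pair; rewrite /= scaler0 addr0.
  have ir U V (h : V `<=` U) (s : F j U) :
      (res h s, 0) = res h ((s, 0) : splus (F j) G U) :> splus (F j) G V.
    by congr pair; rewrite res0.
  have ql U : linear (fun s : splus (F j) G U => s.1 : F j U) by [].
  by exists (SMor il ir), (@SMor _ (splus (F j) G) (F j) _ ql (fun _ _ _ _ => erefl)).
have [i [q qi]] := IH jl.
pose G := \big[@splus k/@szero k]_(i <- l) F i.
have il U : linear (fun s : F j U => (0, i U s) : splus (F a) G U).
  by move=> c s s'; congr pair; rewrite /= ?scaler0 ?addr0 ?smap_lin.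
have ir U V (h : V `<=` U) (s : F j U) :
    (0, i V (res h s)) = res h ((0, i U s) : splus (F a) G U) :> splus (F a) G V.
  by congr pair; rewrite ?res0 ?smap_res.
have ql U : linear (fun s : splus (F a) G U => q U s.2).
  by move=> c s s'; rewrite smap_lin.
have qr U V (h : V `<=` U) (s : splus (F a) G U) : q V (res h s).2 = res h (q U s.2).
  by rewrite -smap_res.
by exists (SMor il ir), (SMor ql qr).
Qed.

(** The product of the [X - a] over the finite points of [l] has divisor [l] up to the
point at infinity, where the total degree is compensated. *)
Lemma ord_prod_divisor (l : seq (P1 k)) x :
  ord_ge x (divisor l x - (if x is None then (size l)%:Z else 0))
    (\prod_(a <- pmap id l) ('X - a%:P))%:F.
Proof.
elim: l => [|[b|] l IH] /=.
- rewrite big_nil tofrac1.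
  have -> : divisor [::] x - (if x is None then 0%:Z else 0) = 0 by case: x.
  by rewrite regularE; exact: regular_at1.
- rewrite big_cons tofracM.
  have Hb : ord_ge x ((Some b == x : nat)%:Z - (if x is None then 1 else 0)) ('X - b%:P)%:F.
    case: x {IH} => [a|] /=.
      rewrite subr0; have [[->]|ab] := eqVneq (Some b) (Some a).
        exact: (ord_ge_uniformizer (Some a) 1).
      by have := regular_poly a ('X - b%:P); rewrite -regularE.
    exists ('X - b%:P), 'X; rewrite polyX_eq0 size_polyX size_XsubC; split=> //.
    by rewrite sub0r /= exprN1 invrK.
  apply: ord_ge_le (ord_geM Hb IH); rewrite /divisor /=.
  by case: x {IH Hb} => [a|] /=; [rewrite !subr0; exact: lexx | lia].
- apply: ord_ge_le IH; rewrite /divisor /=.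
  by case: x => [a|] /=; lia.
Qed.

End DirectSums.

(** * Degrees of a finite parabolic bundle *)

Section Degrees.
Variables (k : closedFieldType) (D : seq (P1 k)) (r : nat) (r_gt0 : (0 < r)%N).
Implicit Types U V : zopen k.
Variables (E : psheaf D r) (lfE : locally_free (E 0)).
Variables (T : nat -> psheaf D r) (T_powers : is_tensor_powers r_gt0 E T).
Variables (n : nat) (d : 'I_n -> int).
Hypothesis E0 : siso (E 0) (sbigplus (fun j => twist k (d j))).

Let lfT i : locally_free (T i 0).
Proof. by have [_ /(_ i)[]] := T_powers. Qed.

Let T_pairing i : exists p : pairing E (T i) (T i.+1), universal_pairing p.
Proof. by have [_ _ /(_ i)] := T_powers. Qed.

Lemma unit_section_in U :
  1 \in osec_pred (fun x : P1 k => - (ceil_index 1 r 0 * divisor D x)) U.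
Proof.
apply/asboolP => x Ux; have -> : ceil_index 1 r 0 = 0.
  by rewrite /ceil_index mul0r oppr0 div0z oppr0.
by rewrite mul0r !oppr0 regularE; exact: regular_at1.
Qed.

Let unit_section U : punit D r_gt0 0 U := OSec (unit_section_in U).

(** A section of [E 0] that vanishes at infinity produces sections of the tensor powers
with zeros of growing order. *)
Lemma positive_summand (P Q : {poly nat}) j :
  0 < d j -> piso (peval T P) (peval T Q) -> P = Q.
Proof.
move=> dj; have [i [q qi]] := summand_sbigplus (fun j => twist k (d j)) j.
have [f [g fg]] := E0.
pose delta x : int := if x == None :> P1 k then d j else 0.
have one_in : 1 \in osec_pred delta (zfull k).
  apply/asboolP => x _; apply: (@ord_ge_le _ _ _ 0).
    by rewrite oppr_le0 /delta; case: ifP => // _; exact: ltW.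
  by have := regular_at1 x; rewrite -regularE.
have X_in : 'X%:F \in osec_pred delta (avoid [:: Some 0]).
  apply/asboolP => -[a|] _.
    by have := regular_poly a 'X; rewrite -regularE.
  apply: (@ord_ge_le _ _ _ (-1)); first by rewrite /delta /=; lia.
  rewrite -[X in ord_ge _ _ X]invrK -[_^-1^-1]/((uniformizer None) ^-1).
  exact: (ord_ge_uniformizer (None : P1 k) (-1)).
(* The constant section 1 vanishes at infinity as a section of O(d_j), because the
   coordinate function is still a section there. *)
pose o : twist k (d j) (zfull k) := OSec one_in.
pose s := g _ (i _ o).
have s_vanishing : vanishing 1 s.
  do 2!apply: vanishing_smor; exists (OSec X_in : twist k (d j) _).
  apply/val_inj; rewrite /= mulVf //.
  by rewrite tofrac_eq0 polyX_eq0.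
have s0 : s <> 0.
  move=> s0; have : q _ (f _ s) = o by rewrite /s; have [_ ->] := fg (zfull k).
  rewrite s0 !smap0 => /(congr1 (@osecval _ _ _)) /= /eqP.
  by rewrite eq_sym oner_eq0.
apply: (@growth_injective _ _ _ (@dim_section k D r)).
- by move=> t E' e e'; exact: hasdim_uniq.
- exact: dim_section_zero.
- exact: dim_section_plus.
- exact: dim_section_iso.
- by move=> t m; exact: dim_section_exists.
- move=> e dim_e; apply/(hasdim_neq0 dim_e).
  have [T0 _ _] := T_powers; rewrite T0.
  exists (unit_section (zfull k)).
    by exists (unit_section _); rewrite expr0 scale1r; apply/val_inj.
  by move/(congr1 (@osecval _ _ _)) => /= /eqP; rewrite oner_eq0.
- move=> t m e e' dim_e e0 dim_e'; apply/(hasdim_neq0 dim_e').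
  have [s' s'_vanishing s'0] := proj1 (hasdim_neq0 dim_e) e0.
  have [p up] := T_pairing m.
  exists (p 0 0 _ s s'); last exact: (universal_pairing_neq0 r_gt0 up).
  exact: (vanishing_bimor (p 0 0) s_vanishing s'_vanishing).
- by move=> m; exact: dim_section_bounded.
Qed.

(** A map from [E] to the unit shifted by one step produces maps from the tensor powers
to further shifts of the unit. *)
Lemma negative_summand (P Q : {poly nat}) j :
  (0 < size D)%N -> d j <= - (size D)%:Z -> piso (peval T P) (peval T Q) -> P = Q.
Proof.
move=> D0 dj; have [i [q qi]] := summand_sbigplus (fun j => twist k (d j)) j.
have [f [g fg]] := E0.
(* Multiplication by [G] embeds O(d_j) into O(- D): at infinity this uses the bound
   on [d j]. *)
pose G : {poly k} := \prod_(a <- pmap id D) ('X - a%:P).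
have lam_in U (s : twist k (d j) U) :
    G%:F * osecval s \in osec_pred (fun x => - divisor D x) U.
  apply/asboolP => x Ux; have := ord_geM (ord_prod_divisor D x) (osec_ord s Ux).
  apply: ord_ge_le; rewrite opprK; case: x {Ux} => [a|] /=; first by rewrite oppr0 !addr0.
  by rewrite -addrA lerDl subr_ge0.
pose l U (s : E 0 U) : OX (fun x => - divisor D x) U := OSec (lam_in U (q U (f U s))).
have l_lin U : linear (l U).
  by move=> c u v; apply/val_inj; rewrite /= !smap_lin /= mulrDr mulrCA.
have l_res U V (h : V `<=` U) (s : E 0 U) : l V (res h s) = res h (l U s).
  by apply/val_inj; rewrite /= !smap_res.
have [lam lamP lamE] := functional_extends r_gt0 (SMor l_lin l_res).
have {}lamP : functional (fun=> 0) 1 lam.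
  by move: lamP; congr functional; apply/funext => x; rewrite addNr.
have [U [s lams]] : exists U (s : E 0 U), lam 0 U s != 0.
  pose U := avoid [:: None : P1 k].
  have one_in : 1 \in osec_pred (fun x => if x == None :> P1 k then d j else 0) U.
    apply/asboolP => -[a|] //= _.
    by have := regular_at1 (Some a : P1 k); rewrite -regularE.
  exists U, (g _ (i _ (OSec one_in : twist k (d j) U))).
  rewrite lamE /=; have [_ ->] := fg U; rewrite qi mulr1 tofrac_eq0.
  exact/monic_neq0/monic_prod_XsubC.
apply: (@growth_injective _ _ _ (@dim_functional k D r)).
- by move=> t E' e e'; exact: hasdim_uniq.
- exact: dim_functional_zero.
- exact: dim_functional_plus.
- exact: dim_functional_iso.
- by move=> t m; exact: dim_functional_exists.
- move=> e dim_e; apply/(hasdim_neq0 dim_e).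
  have [T0 _ _] := T_powers; rewrite T0.
  exists (fun a U s => osecval s); first exact: functional_unit.
  move/(congr1 (fun phi : rat_family (punit D r_gt0) => phi 0 _ (unit_section (zfull k)))).
  by move=> /= /eqP; rewrite oner_eq0.
- move=> t m e e' dim_e e0 dim_e'; apply/(hasdim_neq0 dim_e').
  have [phi phiP /family_neq0[b [V [s' phis']]]] := proj1 (hasdim_neq0 dim_e) e0.
  have [p up] := T_pairing m.
  have [psi psiP psiE] := functional_tensor r_gt0 up lamP phiP.
  exists psi.
    by rewrite intS; move: psiP; congr functional; apply/funext => x; rewrite addr0.
  move=> psi0; have := psiE 0 b (zcap U V) (res (@zcapl _ _ _) s) (res (@zcapr _ _ _) s').
  rewrite psi0 (functional_res lamP) (functional_res phiP) => /esym/eqP.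
  by rewrite mulf_eq0 (negPf lams) (negPf phis').
- by move=> m; exact: dim_functional_bounded.
Qed.

End Degrees.

Theorem mainTheorem3 (k : closedFieldType) (m : nat) (D : m.-tuple (P1 k))
    (r : nat) (E : psheaf D r) (n : nat) (d : 'I_n -> int) :
  (1 <= m)%N -> uniq D -> (1 <= r)%N ->
  parabolic E -> tame_weights E -> finite_parabolic E ->
  siso (E 0) (sbigplus (fun j => twist k (d j))) ->
  forall j, - m%:Z < d j <= 0.
Proof.
move=> m_gt0 _ _ [lf _] _ [r' [r'_gt0 [_ [T [P [Q [T_powers /eqP PQ iso]]]]]]] E0 j.
have ceil0 : ceil_index r r' 0 = 0 by rewrite /ceil_index mul0r oppr0 div0z oppr0.
have lf' : locally_free (extend r'_gt0 E 0) by exact: lf.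
have E0' : siso (extend r'_gt0 E 0) (sbigplus (fun j => twist k (d j))).
  by rewrite /= ceil0.
have D_gt0 : (0 < size D)%N by rewrite size_tuple.
apply/andP; split.
  rewrite ltNge; apply/negP => dj; apply: PQ.
  have {}dj : d j <= - (size D)%:Z by rewrite size_tuple.
  exact: (negative_summand T_powers E0' D_gt0 dj iso).
rewrite leNgt; apply/negP => dj; apply: PQ.
exact: (positive_summand lf' T_powers E0' dj iso).
Qed.
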